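(* Let $f(q)=q+\sum_{n=2}^{+\infty}q^{n}a_{n}$ be a slice regular function on $\mathbb{B}$ such that the function $q\mapsto qf'(q)$ belongs to $\mathcal{S}^{*}$. Then $|a_{n}|\leq1$ for all $n=2,3,\ldots$. Moreover, equality $|a_{n}|=1$ for a given $n\geq2$ holds if and only if $$f(q)=q(1-qu)^{-\ast},\qquad\forall\, q\in\mathbb{B},$$ for some $u\in\partial\mathbb{B}$.
   Context: $\mathbb{H}$ denotes the quaternions, $\mathbb{B}=\{q\in\mathbb{H}:|q|<1\}$, $\mathbb{S}=\{q\in\mathbb{H}:q^2=-1\}$; for $I\in\mathbb{S}$, $\mathbb{C}_I=\mathbb{R}\oplus I\mathbb{R}$ and $\mathbb{B}_I=\mathbb{B}\cap\mathbb{C}_I$. A function $f:\mathbb{B}\to\mathbb{H}$ is (left) slice regular if for every $I\in\mathbb{S}$ the restriction $f_I=f|_{\mathbb{B}_I}$ has continuous partial derivatives and $\frac12\left(\frac{\partial}{\partial x}+I\frac{\partial}{\partial y}\right)f_I(x+yI)=0$ on $\mathbb{B}_I$; equivalently $f(q)=\sum_{n\ge0}q^na_n$ on $\mathbb{B}$ with $a_n\in\mathbb{H}$. Its slice derivative is $f'(x+yI)=\frac12\left(\frac{\partial}{\partial x}-I\frac{\partial}{\partial y}\right)f_I(x+yI)$, i.e. $f'(q)=\sum_{n\ge1}q^{n-1}na_n$. For slice regular $f=\sum q^na_n$, $g=\sum q^nb_n$ on $\mathbb{B}$: the regular product is $f\ast g(q)=\sum_n q^n\sum_{k=0}^n a_kb_{n-k}$;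 the regular conjugate is $f^c(q)=\sum q^n\overline{a_n}$; the symmetrization is $f^s=f\ast f^c$; the regular reciprocal is $f^{-\ast}(q)=f^s(q)^{-1}f^c(q)$ off the zero set of $f^s$. In particular $q(1-qu)^{-\ast}=\sum_{n\ge1}q^nu^{n-1}$. $\mathcal{S}$ is the set of slice regular $g:\mathbb{B}\to\mathbb{H}$ whose zero set is $\mathcal{Z}_g=\{0\}$ and with $g'(0)=1$. The class of slice starlike functions $\mathcal{S}^{*}$ is the set of $g\in\mathcal{S}$ such that $\mathrm{Re}\big(g(q)^{-1}qg'(q)\big)>0$ for $q\in\mathbb{B}$ (pointwise products; at $q=0$ the expression is understood as its limit value $1$). *)

(* Defs.v *)
From HB Require Import structures.
From mathcomp Require Import all_boot all_order all_algebra.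
From mathcomp Require Import all_classical all_reals all_analysis.
From mathcomp Require Import ring lra.

Set Implicit Arguments.
Unset Strict Implicit.
Unset Printing Implicit Defensive.

Import Order.TTheory GRing.Theory Num.Theory.
Import numFieldNormedType.Exports.

Local Open Scope classical_set_scope.
Local Open Scope ring_scope.

(* [Quat a b c d] is a + b i + c j + d k. *)
Record quat (R : realType) := Quat { qre : R; qi : R; qj : R; qk : R }.

Section QuaternionAlgebra.
Variable R : realType.
Implicit Types p q r : quat R.

Lemma quatP p q :
  qre p = qre q -> qi p = qi q -> qj p = qj q -> qk p = qk q -> p = q.
Proof. by case: p q => [? ? ? ?] [? ? ? ?] /= -> -> -> ->. Qed.

Definition tuple_of_quat q := (qre q, qi q, qj q, qk q).
Definition quat_of_tuple (t : R * R * R * R) :=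
  let: (a, b, c, d) := t in Quat a b c d.
Lemma tuple_of_quatK : cancel tuple_of_quat quat_of_tuple.
Proof. by case. Qed.

HB.instance Definition _ := Choice.copy (quat R) (can_type tuple_of_quatK).

Definition qadd p q :=
  Quat (qre p + qre q) (qi p + qi q) (qj p + qj q) (qk p + qk q).
Definition qopp q := Quat (- qre q) (- qi q) (- qj q) (- qk q).
Definition qzero : quat R := Quat 0 0 0 0.
Definition qone : quat R := Quat 1 0 0 0.
Definition qmul p q :=
  Quat (qre p * qre q - qi p * qi q - qj p * qj q - qk p * qk q)
       (qre p * qi q + qi p * qre q + qj p * qk q - qk p * qj q)
       (qre p * qj q - qi p * qk q + qj p * qre q + qk p * qi q)
       (qre p * qk q + qi p * qj q - qj p * qi q + qk p * qre q).
Definition qscale (t : R) q := Quat (t * qre q) (t * qi q) (t * qj q) (t * qk q).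
Definition qconj q := Quat (qre q) (- qi q) (- qj q) (- qk q).
Definition qsqn q := qre q ^+ 2 + qi q ^+ 2 + qj q ^+ 2 + qk q ^+ 2.
Definition qinv q := qscale (qsqn q)^-1 (qconj q).

Local Ltac by_coord := move=> *; apply: quatP => /=; ring.

Fact qaddA : associative qadd. Proof. by by_coord. Qed.
Fact qaddC : commutative qadd. Proof. by by_coord. Qed.
Fact qadd0 : left_id qzero qadd. Proof. by by_coord. Qed.
Fact qaddN : left_inverse qzero qopp qadd. Proof. by by_coord. Qed.
HB.instance Definition _ :=
  GRing.isZmodule.Build (quat R) qaddA qaddC qadd0 qaddN.

Fact qmulA : associative qmul. Proof. by by_coord. Qed.
Fact qmul1l : left_id qone qmul. Proof. by by_coord. Qed.
Fact qmul1r : right_id qone qmul. Proof. by by_coord. Qed.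
Fact qmulDl : left_distributive qmul qadd. Proof. by by_coord. Qed.
Fact qmulDr : right_distributive qmul qadd. Proof. by by_coord. Qed.
Fact qone_neq0 : qone != 0.
Proof. by apply/eqP => -[] /eqP; rewrite oner_eq0. Qed.
HB.instance Definition _ := GRing.Zmodule_isNzRing.Build (quat R)
  qmulA qmul1l qmul1r qmulDl qmulDr qone_neq0.

Fact qscaleA s t q : qscale s (qscale t q) = qscale (s * t) q.
Proof. by by_coord. Qed.
Fact qscale1 : left_id 1 qscale. Proof. by by_coord. Qed.
Fact qscaleDr : right_distributive qscale +%R. Proof. by by_coord. Qed.
Fact qscaleDl q : {morph qscale^~ q : s t / s + t}. Proof. by by_coord. Qed.
HB.instance Definition _ := GRing.Zmodule_isLmodule.Build R (quat R)
  qscaleA qscale1 qscaleDr qscaleDl.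

Fact qscaleAl t p q : t *: (p * q) = (t *: p) * q. Proof. by by_coord. Qed.
HB.instance Definition _ := GRing.Lmodule_isLalgebra.Build R (quat R) qscaleAl.
Fact qscaleAr t p q : t *: (p * q) = p * (t *: q). Proof. by by_coord. Qed.
HB.instance Definition _ := GRing.Lalgebra_isAlgebra.Build R (quat R) qscaleAr.

Lemma qsqn_ge0 q : 0 <= qsqn q.
Proof. by rewrite !addr_ge0 ?sqr_ge0. Qed.

Lemma qsqn_eq0 q : (qsqn q == 0) = (q == 0).
Proof.
apply/eqP/eqP => [|->]; last by rewrite /qsqn /= expr0n /= !addr0.
case: q => a b c d; rewrite /qsqn /= => /eqP.
rewrite !paddr_eq0 ?addr_ge0 ?sqr_ge0 // !sqrf_eq0.
by move=> /andP[/andP[/andP[/eqP-> /eqP->] /eqP->] /eqP->].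
Qed.

Lemma qsqnM p q : qsqn (p * q) = qsqn p * qsqn q.
Proof. by rewrite /qsqn /=; ring. Qed.

Fact qmulVr : {in [pred q : quat R | q != 0], left_inverse 1 qinv *%R}.
Proof.
move=> q; rewrite inE -qsqn_eq0 => q0.
by apply: quatP; rewrite /= /qsqn; field.
Qed.
Fact qmulrV : {in [pred q : quat R | q != 0], right_inverse 1 qinv *%R}.
Proof.
move=> q; rewrite inE -qsqn_eq0 => q0.
by apply: quatP; rewrite /= /qsqn; field.
Qed.
Fact qunitP p q : q * p = 1 /\ p * q = 1 -> p != 0.
Proof.
by move=> [qp _]; apply/eqP => p0; move/eqP: qp; rewrite p0 mulr0 eq_sym oner_eq0.
Qed.
Fact qinv_out : {in [predC [pred q : quat R | q != 0]], qinv =1 id}.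
Proof.
move=> q; rewrite !inE negbK => /eqP ->.
by apply: quatP; rewrite /= ?oppr0 mulr0.
Qed.
HB.instance Definition _ := GRing.NzRing_hasMulInverse.Build (quat R)
  qmulVr qmulrV qunitP qinv_out.

Definition qnorm q := Num.sqrt (qsqn q).

Lemma qnorm_le p q : qnorm (p + q) <= qnorm p + qnorm q.
Proof.
rewrite /qnorm -(@ler_pXn2r _ 2) ?nnegrE ?addr_ge0 ?sqrtr_ge0 //.
rewrite sqrrD !sqr_sqrtr ?qsqn_ge0 // -sqrtrM ?qsqn_ge0 //.
set dot := qre p * qre q + qi p * qi q + qj p * qj q + qk p * qk q.
have dotE : qsqn (p + q) = qsqn p + dot *+ 2 + qsqn q.
  by rewrite /qsqn /dot /=; ring.
rewrite dotE lerD2r lerD2l lerMn2r /=.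
rewrite (le_trans (ler_norm _)) // -sqrtr_sqr ler_sqrt ?mulr_ge0 ?qsqn_ge0 //.
rewrite -subr_ge0.
have -> : qsqn p * qsqn q - dot ^+ 2 =
   (qre p * qi q - qi p * qre q) ^+ 2 + (qre p * qj q - qj p * qre q) ^+ 2 +
   (qre p * qk q - qk p * qre q) ^+ 2 + (qi p * qj q - qj p * qi q) ^+ 2 +
   (qi p * qk q - qk p * qi q) ^+ 2 + (qj p * qk q - qk p * qj q) ^+ 2.
  by rewrite /qsqn /dot; ring.
by rewrite !addr_ge0 ?sqr_ge0.
Qed.

Lemma qnormZ t q : qnorm (t *: q) = `|t| * qnorm q.
Proof.
rewrite /qnorm -sqrtr_sqr -sqrtrM ?sqr_ge0 //; congr Num.sqrt.
by rewrite /qsqn /=; ring.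
Qed.

Lemma qnorm_eq0 q : qnorm q = 0 -> q = 0.
Proof.
move=> /eqP; rewrite sqrtr_eq0 => q0; apply/eqP.
by rewrite -qsqn_eq0 eq_le q0 qsqn_ge0.
Qed.

HB.instance Definition _ := Lmodule_isNormed.Build R (quat R)
  qnorm_le qnormZ qnorm_eq0.

Lemma qnormE q : `|q| = Num.sqrt (qsqn q). Proof. by []. Qed.

Lemma qnormM p q : `|p * q| = `|p| * `|q|.
Proof. by rewrite !qnormE qsqnM sqrtrM // qsqn_ge0. Qed.

End QuaternionAlgebra.

Section SliceRegular.
Variable R : realType.
Implicit Types (I p q u : quat R) (f g : quat R -> quat R) (a b : nat -> quat R).

Definition unit_ball : set (quat R) := [set q | `|q| < 1].

Definition imag_sphere : set (quat R) := [set I | I ^+ 2 = -1].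

(* The point x + yI of the slice C_I. *)
Definition slice_pt I (x y : R) : quat R := x%:A + y *: I.

(* Functions on the unit ball are total functions of which only the values on
   the ball matter: the ball being open, the derivatives below are determined
   there by those values. *)
Definition slice_dx f I (x y : R) : quat R :=
  derive1 (fun t : R => f (slice_pt I t y)) x.
Definition slice_dy f I (x y : R) : quat R :=
  derive1 (fun t : R => f (slice_pt I x t)) y.

Definition slice_regular f := forall I, imag_sphere I ->
  forall x y : R, unit_ball (slice_pt I x y) ->
  [/\ derivable (fun t : R => f (slice_pt I t y)) x 1,
      derivable (fun t : R => f (slice_pt I x t)) y 1,
      {for (x, y), continuous (fun z : R * R => slice_dx f I z.1 z.2)},
      {for (x, y), continuous (fun z : R * R => slice_dy f I z.1 z.2)} &
      2^-1 *: (slice_dx f I x y + I * slice_dy f I x y) = 0].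

Definition qim q : quat R := Quat 0 (qi q) (qj q) (qk q).

(* An imaginary unit I such that q lies in C_I; the choice of i for real q is
   immaterial, see [slice_deriveE]. *)
Definition slice_unit q : quat R :=
  if qim q == 0 then Quat 0 1 0 0 else `|qim q|^-1 *: qim q.

Definition slice_derive f q : quat R :=
  let I := slice_unit q in let x := qre q in let y := `|qim q| in
  2^-1 *: (slice_dx f I x y - I * slice_dy f I x y).

Lemma sqr_eqN1P I : imag_sphere I -> qre I = 0 /\ qsqn I = 1.
Proof.
case: I => a b c d; rewrite /imag_sphere /= expr2 => e.
have := congr1 (@qre R) e; have := congr1 (@qi R) e.
have := congr1 (@qj R) e; have := congr1 (@qk R) e.
rewrite /qsqn /= !oppr0 => ek ej ei er.
have a0 : a = 0.
  have [//|a0] := eqVneq a 0; exfalso.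
  have E z : a * z + z * a = 0 -> z = 0.
    move=> h; have : a * z = 0 by lra.
    by move=> /eqP; rewrite mulf_eq0 (negPf a0) => /eqP.
  have b0 : b = 0 by apply: E; lra.
  have c0 : c = 0 by apply: E; lra.
  have d0 : d = 0 by apply: E; lra.
  by move: er; rewrite b0 c0 d0; nra.
by split=> //; move: er; rewrite a0; lra.
Qed.

Lemma slice_unit_sphere q : imag_sphere (slice_unit q).
Proof.
rewrite /imag_sphere /slice_unit /=; case: eqVneq => [_|q0].
  by rewrite expr2; apply: quatP => /=; ring.
have N0 : `|qim q| != 0 by rewrite normr_eq0.
have N2 : `|qim q| ^+ 2 = qsqn (qim q) by rewrite qnormE sqr_sqrtr ?qsqn_ge0.
rewrite exprZn exprVn N2.
have -> : qim q ^+ 2 = (- qsqn (qim q))%:A.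
  by rewrite expr2; apply: quatP; rewrite /qsqn /=; ring.
by rewrite scalerA mulrN mulVf ?scaleN1r // qsqn_eq0.
Qed.

Lemma qre_slice_pt I x y : imag_sphere I -> qre (slice_pt I x y) = x.
Proof. by move=> /sqr_eqN1P [I0 _]; rewrite /= I0; ring. Qed.

Lemma qim_slice_pt I x y : imag_sphere I -> qim (slice_pt I x y) = y *: I.
Proof. by move=> /sqr_eqN1P [I0 _]; apply: quatP; rewrite /= ?I0; ring. Qed.

Lemma slice_unitE q : `|qim q| *: slice_unit q = qim q.
Proof.
rewrite /slice_unit; case: eqVneq => [->|q0]; first by rewrite normr0 scale0r.
by rewrite scalerA divff ?scale1r // normr_eq0.
Qed.

Lemma slice_deriveE f I (x y : R) : slice_regular f -> imag_sphere I ->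
  unit_ball (slice_pt I x y) ->
  slice_derive f (slice_pt I x y) =
    2^-1 *: (slice_dx f I x y - I * slice_dy f I x y).
Proof.
move=> hf hI hq; rewrite /slice_derive qre_slice_pt //.
set q := slice_pt I x y in hq *.
have e : `|qim q| *: slice_unit q = y *: I by rewrite slice_unitE qim_slice_pt.
have ept t : slice_pt (slice_unit q) t `|qim q| = slice_pt I t y.
  by rewrite /slice_pt e.
have CR J z : imag_sphere J -> unit_ball (slice_pt J x z) ->
    2^-1 *: (slice_dx f J x z - J * slice_dy f J x z) = slice_dx f J x z.
  move=> hJ hz; have [_ _ _ _ /eqP] := hf J hJ x z hz.
  rewrite scaler_eq0 invr_eq0 pnatr_eq0 /= addr_eq0 => /eqP E.
  rewrite -E -mulr2n -(scaler_nat 2 (slice_dx f J x z)).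
  by rewrite scalerA mulVf ?scale1r // pnatr_eq0.
have hJ := @slice_unit_sphere q.
rewrite (CR I y hI hq) (CR _ `|qim q| hJ); last by rewrite ept.
by congr (derive1 _ x); apply/funext => t; rewrite ept.
Qed.

Definition class_S g :=
  [/\ slice_regular g,
      forall q, unit_ball q -> (g q = 0 <-> q = 0) &
      slice_derive g 0 = 1].

(* At 0 the expression is given its limit value 1. *)
Definition starlike_quotient g q : quat R :=
  if q == 0 then 1 else (g q)^-1 * q * slice_derive g q.

Definition slice_starlike g :=
  class_S g /\ forall q, unit_ball q -> 0 < qre (starlike_quotient g q).

(* The regular operations act on coefficient sequences, [a] standing for the
   slice regular function whose value at q is the sum of the q ^+ n * a n. *)
Definition qpseries a q : quat R := limn (series (fun n => q ^+ n * a n)).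

Definition reg_mul a b : nat -> quat R :=
  fun n => \sum_(k < n.+1) a k * b (n - k)%N.
Definition reg_conj a : nat -> quat R := fun n => qconj (a n).
Definition reg_sym a : nat -> quat R := reg_mul a (reg_conj a).

Definition reg_recip a q : quat R :=
  (qpseries (reg_sym a) q)^-1 * qpseries (reg_conj a) q.

(* The coefficients of q |-> 1 - qu. *)
Definition one_sub_qmul u : nat -> quat R :=
  fun n => if n == 0%N then 1 else if n == 1%N then - u else 0.

End SliceRegular.

Arguments unit_ball {R}.
Arguments imag_sphere {R}.

(* Main.v *)
Require Import Defs.
From HB Require Import structures.
From mathcomp Require Import all_boot all_order all_algebra.
From mathcomp Require Import all_classical all_reals all_analysis.
From mathcomp Require Import ring lra.
From mathcomp Require Import complex.

Import Order.TTheory GRing.Theory Num.Theory.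
Import numFieldNormedType.Exports.

Local Open Scope classical_set_scope.
Local Open Scope ring_scope.

(* Let c and d be the coefficients of f' and of g', where g = q f', so that
   d_n = (n + 1) c_n.  The starlikeness of g says Re (conj f' . g') > 0 on the
   ball.  Let p be the regular quotient, d = c * p.  If p converges then, at a
   point q, its value is f'(q')^-1 g'(q') for some q' on the sphere of q, hence
   has positive real part, and a Caratheodory argument gives |p_n| <= 2, with
   |p_1| = 2 only if p_n = 2 u^n for all n >= 1.  The relation
   n c_n = \sum_(k < n) c_k p_(n - k) then bounds |c_n| by n + 1.

   The convergence of p is avoided by dilating and truncating f' and g' to
   polynomials that keep the positivity on the closed ball: the symmetrization
   of such an f' is a real polynomial whose complex roots all lie outside the
   closed disc, so the coefficients of the regular quotient are absolutely
   summable.  Only the averages of the quotient against nonnegative cosine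
   weights over roots of unity are used; they involve finitely many
   coefficients, and the dilation parameter then goes to 1. *)

Set Implicit Arguments.
Unset Strict Implicit.
Unset Printing Implicit Defensive.

(** * Quaternions *)

Section Quat.
Variable R : realType.
Implicit Types p q u v w : quat R.

Lemma qconjK : involutive (@qconj R).
Proof. by move=> q; apply: quatP => /=; rewrite ?opprK. Qed.

Lemma qconjM p q : qconj (p * q) = qconj q * qconj p.
Proof. by apply: quatP => /=; ring. Qed.

Lemma qconjD p q : qconj (p + q) = qconj p + qconj q.
Proof. by apply: quatP => /=; ring. Qed.

Lemma qconj1 : qconj (1 : quat R) = 1.
Proof. by apply: quatP => /=; ring. Qed.

Lemma qconj0 : qconj (0 : quat R) = 0.
Proof. by apply: quatP => /=; ring. Qed.

Lemma qconjX q n : qconj (q ^+ n) = qconj q ^+ n.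
Proof.
elim: n => [|n IH]; first by rewrite !expr0 qconj1.
by rewrite exprS qconjM IH -exprSr.
Qed.

Lemma qconj_sum (I : Type) (r : seq I) (P : pred I) (F : I -> quat R) :
  qconj (\sum_(i <- r | P i) F i) = \sum_(i <- r | P i) qconj (F i).
Proof. exact: (big_morph _ qconjD qconj0). Qed.

Lemma qconj_fixed q : qconj q = q -> q = (qre q)%:A.
Proof.
move=> h; have := congr1 (@qi R) h; have := congr1 (@qj R) h.
have := congr1 (@qk R) h => /= hk hj hi.
apply: quatP => /=; lra.
Qed.

Lemma qsqnE q : qsqn q = `|q| ^+ 2.
Proof. by rewrite qnormE sqr_sqrtr // qsqn_ge0. Qed.

Lemma qnorm_conj q : `|qconj q| = `|q|.
Proof. by rewrite !qnormE; congr Num.sqrt; rewrite /qsqn /=; ring. Qed.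

Lemma qmul_conj q : q * qconj q = (`|q| ^+ 2)%:A.
Proof. by rewrite -qsqnE; apply: quatP; rewrite /qsqn /=; ring. Qed.

Lemma qconj_mul q : qconj q * q = (`|q| ^+ 2)%:A.
Proof. by rewrite -qsqnE; apply: quatP; rewrite /qsqn /=; ring. Qed.

Lemma qnorm1 : `|1 : quat R| = 1.
Proof. by rewrite qnormE /qsqn /= expr1n expr0n !addr0 sqrtr1. Qed.

Lemma qnorm_alg (t : R) : `|t%:A : quat R| = `|t|.
Proof. by rewrite normrZ qnorm1 mulr1. Qed.

Lemma qnormX q n : `|q ^+ n| = `|q| ^+ n.
Proof.
by elim: n => [|n IH]; rewrite ?expr0 ?qnorm1 // !exprS qnormM IH.
Qed.

Lemma qunitE q : (q \is a GRing.unit) = (q != 0).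
Proof. by []. Qed.

Lemma qnormV q : `|q^-1| = `|q|^-1.
Proof.
have [->|q0] := eqVneq q 0; first by rewrite invr0 normr0 invr0.
apply: (mulfI (x := `|q|)); first by rewrite normr_eq0.
by rewrite -qnormM divrr ?qunitE // qnorm1 divff // normr_eq0.
Qed.

Lemma qmul_eq0 p q : (p * q == 0) = (p == 0) || (q == 0).
Proof. by rewrite -normr_eq0 qnormM mulf_eq0 !normr_eq0. Qed.

Lemma qreD p q : qre (p + q) = qre p + qre q. Proof. by []. Qed.
Lemma qreZ (t : R) q : qre (t *: q) = t * qre q. Proof. by []. Qed.
Lemma qreC p q : qre (p * q) = qre (q * p). Proof. by rewrite /=; ring. Qed.
Lemma qre_sum (I : Type) (r : seq I) (P : pred I) (F : I -> quat R) :
  qre (\sum_(i <- r | P i) F i) = \sum_(i <- r | P i) qre (F i).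
Proof. exact: (big_morph _ qreD (erefl _)). Qed.

Lemma qre_conj q : qre (qconj q) = qre q. Proof. by []. Qed.

Lemma qre_alg (t : R) : qre (t%:A : quat R) = t.
Proof. by rewrite /= mulr1. Qed.

Lemma normr_qre q : `|qre q| <= `|q|.
Proof.
rewrite qnormE -sqrtr_sqr ler_sqrt ?qsqn_ge0 //.
by rewrite /qsqn -!addrA lerDl !addr_ge0 ?sqr_ge0.
Qed.

Lemma sqr_quat q : q ^+ 2 = (2 * qre q) *: q - (`|q| ^+ 2)%:A.
Proof. by rewrite -qsqnE expr2; apply: quatP; rewrite /qsqn /=; ring. Qed.

Lemma qconj_alt q : qconj q = (2 * qre q)%:A - q.
Proof. by apply: quatP => /=; ring. Qed.

Lemma alg_comm (t : R) q : t%:A * q = q * t%:A.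
Proof. by rewrite mulr_algl mulr_algr. Qed.

(** The real parts of p^-1 q and of conj(p) q differ by the factor |p|^2, so positivity of a
    quotient can be stated without inverses. *)
Lemma qre_conjmul_sqn p q v : p * v = q ->
  qre (qconj p * q) = `|p| ^+ 2 * qre v.
Proof. by move=> <-; rewrite mulrA qconj_mul mulr_algl qreZ. Qed.

Lemma qnormB_sqr p q :
  `|p - q| ^+ 2 = `|p| ^+ 2 + `|q| ^+ 2 - 2 * qre (qconj p * q).
Proof. by rewrite -!qsqnE /qsqn /=; ring. Qed.

(* [s X + r] is the remainder of [X^n] modulo the real quadratic polynomial that
   vanishes on the sphere. *)
Lemma exprn_sphere (x m : R) (n : nat) : exists s r : R,
  forall q, qre q = x -> `|q| = m -> q ^+ n = s *: q + r%:A.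
Proof.
elim: n => [|n [s [r IH]]].
  by exists 0, 1 => q _ _; rewrite expr0 scale0r add0r scale1r.
exists (s * (2 * x) + r), (- (s * m ^+ 2)) => q hx hm.
rewrite exprS IH // mulrDr -scalerAr -expr2 sqr_quat hx hm mulr_algr.
rewrite scalerBr !scalerA scalerDl scaleNr.
by rewrite -!addrA; congr (_ + _); rewrite addrC.
Qed.

End Quat.

(** * Left evaluation of quaternionic polynomials *)

Section LeftEval.
Variable R : realType.
Implicit Types (p q u v w : quat R) (A B : {poly quat R}).

(** Powers stand to the left of the coefficients, as in slice regular series; [horner] puts them on
    the right. *)
Definition lev q A : quat R := \sum_(i < size A) q ^+ i * A`_i.

Lemma lev_widen q A n : (size A <= n)%N -> lev q A = \sum_(i < n) q ^+ i * A`_i.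
Proof.
move=> hn; rewrite /lev (big_ord_widen n (fun i => q ^+ i * A`_i)) //.
rewrite big_mkcond /=; apply: eq_bigr => i _.
by case: ltnP => // h; rewrite nth_default ?mulr0.
Qed.

Lemma levD q A B : lev q (A + B) = lev q A + lev q B.
Proof.
set n := maxn (size A) (size B).
rewrite (@lev_widen q (A + B) n) ?size_polyD // (@lev_widen q A n) ?leq_maxl //.
rewrite (@lev_widen q B n) ?leq_maxr // -big_split /=.
by apply: eq_bigr => i _; rewrite coefD mulrDr.
Qed.

Lemma levC q b : lev q b%:P = b.
Proof.
by rewrite (@lev_widen _ _ 1) ?size_polyC_leq1 // big_ord1 coefC expr0 mul1r.
Qed.

Lemma lev0 q : lev q 0 = 0. Proof. exact: (levC q 0). Qed.

Lemma lev_MX q A : lev q (A * 'X) = q * lev q A.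
Proof.
rewrite (@lev_widen _ _ (size A).+1); last first.
  by have [->|/size_mulX->//] := eqVneq A 0; rewrite mul0r size_poly0.
rewrite big_ord_recl coefMX mulr0 add0r /lev mulr_sumr.
by apply: eq_bigr => i _; rewrite coefMX /= exprS mulrA.
Qed.

Lemma lev_MC q A b : lev q (A * b%:P) = lev q A * b.
Proof.
rewrite (@lev_widen _ _ (size A)).
  by rewrite /lev mulr_suml; apply: eq_bigr => i _; rewrite coefMC mulrA.
apply/leq_sizeP => j hj; rewrite coefMC nth_default ?mul0r //.
Qed.

(** The product formula (A B)(q) = A(q) B(A(q)^-1 q A(q)), with the conjugation written as a
    commutation relation. Each factor ['X] of [B] puts a [q] on the left, which the relation moves
    across A(q) as [q']. *)
Lemma lev_mul q q' A B : q * lev q A = lev q A * q' ->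
  lev q (A * B) = lev q A * lev q' B.
Proof.
move=> h; elim/poly_ind: B => [|B b IH]; first by rewrite mulr0 !lev0 mulr0.
rewrite mulrDr mulrA !levD !lev_MX !lev_MC levC IH.
by rewrite mulrA h mulrDr -mulrA.
Qed.

(** By [exprn_sphere] every power is a real affine function of [q] on the sphere, and real scalars
    commute with the coefficients; the same [S] and [T] thus serve both evaluations. *)
Lemma lev_sphere A (x m : R) : exists S T, forall q, qre q = x -> `|q| = m ->
  lev q A = q * S + T /\ A.[q] = S * q + T.
Proof.
have : forall n, exists sr : R * R,
   forall q, qre q = x -> `|q| = m -> q ^+ n = sr.1 *: q + sr.2%:A.
  by move=> n; have [s [r h]] := exprn_sphere x m n; exists (s, r).
move=> /choice[sr hsr].
exists (\sum_(i < size A) (sr i).1 *: A`_i), (\sum_(i < size A) (sr i).2 *: A`_i).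
move=> q hx hm; split.
  rewrite /lev mulr_sumr -big_split /=; apply: eq_bigr => i _.
  by rewrite (hsr i q) // mulrDl mulr_algl -scalerAl -scalerAr.
rewrite horner_coef mulr_suml -big_split /=; apply: eq_bigr => i _.
by rewrite (hsr i q) // mulrDr mulr_algr -scalerAl -scalerAr.
Qed.

Lemma conjugate_norm v q : v != 0 -> `|v * q * v^-1| = `|q|.
Proof.
by move=> v0; rewrite !qnormM qnormV mulrAC divff ?mul1r // normr_eq0.
Qed.

Lemma conjugate_qre v q : v != 0 -> qre (v * q * v^-1) = qre q.
Proof. by move=> v0; rewrite qreC mulrA mulVr ?mul1r. Qed.

(** With [S] and [T] from [lev_sphere], the left value at S w S^-1 is S w + T, which is the right
    value at [w]. If S = 0, both values are T. *)
Lemma horner_zero_lev_zero A w : A.[w] = 0 ->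
  exists q, [/\ qre q = qre w, `|q| = `|w| & lev q A = 0].
Proof.
have [S [T h]] := lev_sphere A (qre w) `|w|.
have [lw -> //] := h w erefl erefl.
move=> /eqP; rewrite addr_eq0 => /eqP ST; have [S0|S0] := eqVneq S 0.
  exists w; split => //; rewrite lw S0 mulr0 add0r.
  by move/eqP: ST; rewrite S0 mul0r eq_sym oppr_eq0 => /eqP.
exists (S * w * S^-1); split; rewrite ?conjugate_norm ?conjugate_qre //.
have [-> _] := h _ (conjugate_qre w S0) (conjugate_norm w S0).
by rewrite -mulrA mulVr // mulr1 ST addNr.
Qed.

(* [q |-> A(q)^-1 q A(q)] maps each sphere free of zeros of [A] onto itself. *)
Lemma lev_conjugate_onto A q :
  (forall w, qre w = qre q -> `|w| = `|q| -> lev w A != 0) ->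
  exists q', [/\ qre q' = qre q, `|q'| = `|q| & q' * lev q' A = lev q' A * q].
Proof.
move=> hA; set v := A.[qconj q].
have v0 : v != 0.
  apply/negP => /eqP /horner_zero_lev_zero [w [h1 h2 h3]].
  by move: (hA w); rewrite h1 h2 h3 qre_conj qnorm_conj eqxx => /(_ erefl erefl).
exists (v * q * v^-1); split; rewrite ?conjugate_norm ?conjugate_qre //.
have [S [T h]] := lev_sphere A (qre q) `|q|.
have [_] := h (qconj q) (qre_conj q) (qnorm_conj q); rewrite -/v => vE.
have [-> _] := h _ (conjugate_qre q v0) (conjugate_norm q v0).
have TE : T = v - S * qconj q by rewrite vE addrC addKr.
have [e SE] : exists e, S = v * e by exists (v^-1 * S); rewrite mulrA divrr ?mul1r.
have -> : v * q * v^-1 * S + T = v * (q * e + 1 - e * qconj q).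
  rewrite TE SE -(mulrA _ v^-1) mulKr // !mulrDr mulr1 mulrN.
  by rewrite addrA !mulrA.
rewrite -(mulrA _ v^-1) mulKr // -!mulrA; congr (_ * _).
(* What remains is that q e - e conj(q) commutes with q; this follows from q^2 = 2 Re(q) q -
   |q|^2. *)
have e1 : q * (q * e) = (2 * qre q) *: (q * e) - (`|q| ^+ 2) *: e.
  by rewrite mulrA -expr2 sqr_quat mulrBl mulr_algl scalerAl.
have e2 : e * qconj q * q = (`|q| ^+ 2) *: e by rewrite -mulrA qconj_mul mulr_algr.
have e3 : q * (e * qconj q) = (2 * qre q) *: (q * e) - q * e * q.
  by rewrite qconj_alt !mulrBr mulr_algr -scalerAr mulrA.
rewrite mulrBr mulrDr mulr1 mulrBl mulrDl mul1r e1 e2 e3.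
by rewrite opprB [LHS]addrC -[in LHS](addrA _ _ q) subrKA [RHS]addrAC addrA.
Qed.

End LeftEval.

(** * Summability of regular quotients *)

Section Decay.
Variable R : realType.
Implicit Types (p q v w z : quat R) (A B G : {poly quat R}) (y e : nat -> quat R).

Definition conjp A : {poly quat R} := \poly_(i < size A) qconj A`_i.

Lemma coef_conjp A i : (conjp A)`_i = qconj A`_i.
Proof.
rewrite coef_poly; case: ltnP => // h.
by rewrite nth_default // qconj0.
Qed.

Lemma conjpM A B : conjp (A * B) = conjp B * conjp A.
Proof.
apply/polyP => i; rewrite coef_conjp coefM coefMr qconj_sum.
by apply: eq_bigr => j _; rewrite qconjM !coef_conjp.
Qed.

Lemma conjpK A : conjp (conjp A) = A.
Proof. by apply/polyP => i; rewrite !coef_conjp qconjK. Qed.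

Lemma lev_conjp q A : lev q (conjp A) = qconj A.[qconj q].
Proof.
rewrite (@lev_widen _ _ _ (size A)) ?size_poly // horner_coef qconj_sum.
apply: eq_bigr => i _; rewrite coef_conjp qconjM qconjX qconjK //.
Qed.

(** The left value of [conjp A] is the conjugate of a right value of [A], nonzero by
    [horner_zero_lev_zero]; the product formula then evaluates the second factor at a conjugate of
    [q], on the same sphere. *)
Lemma lev_symmetrization_neq0 A q :
  (forall w, qre w = qre q -> `|w| = `|q| -> lev w A != 0) ->
  lev q (conjp A * A) != 0.
Proof.
move=> hA; set v := lev q (conjp A).
have v0 : v != 0.
  rewrite /v lev_conjp -normr_eq0 qnorm_conj normr_eq0.
  apply/negP => /eqP /horner_zero_lev_zero [w [h1 h2 h3]].
  by move: (hA w); rewrite h1 h2 h3 qre_conj qnorm_conj eqxx => /(_ erefl erefl).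
have V0 : v^-1 != 0 by rewrite -normr_eq0 qnormV invr_eq0 normr_eq0.
have hq : q * v = v * (v^-1 * q * v) by rewrite !mulrA mulrV // mul1r.
rewrite (lev_mul _ hq) qmul_eq0 negb_or v0 /=.
have := conjugate_qre q V0; have := conjugate_norm q V0; rewrite invrK => h1 h2.
exact: hA.
Qed.

(** Embedding onto the slice of i, used to transport factorizations over the algebraically closed
    field [R[i]]. *)
Definition quat_of_complex (z : R[i]) : quat R := Quat (complex.Re z) (complex.Im z) 0 0.

Fact quat_of_complex_is_zmod_morphism : zmod_morphism quat_of_complex.
Proof. by move=> [a b] [c d]; apply: quatP => /=; rewrite ?subr0. Qed.
HB.instance Definition _ := GRing.isZmodMorphism.Build _ _ quat_of_complex
  quat_of_complex_is_zmod_morphism.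
Fact quat_of_complex_is_monoid_morphism : monoid_morphism quat_of_complex.
Proof.
by split => [|[a b] [c d]]; apply: quatP => //=; ring.
Qed.
HB.instance Definition _ := GRing.isMonoidMorphism.Build _ _ quat_of_complex
  quat_of_complex_is_monoid_morphism.

(** Coefficients fixed by conjugation are real, so [G] comes from a complex polynomial, which
    splits. Real coefficients commute with powers, hence a complex root in the closed disc would be
    a zero of the left evaluation. *)
Lemma real_poly_factor G : conjp G = G -> (forall q, `|q| <= 1 -> lev q G != 0) ->
  exists (k : quat R) (zs : seq (quat R)), [/\ k != 0,
    forall z, z \in zs -> 1 < `|z| & G = k%:P * \prod_(z <- zs) ('X - z%:P)].
Proof.
move=> hG hz.
have Gre i : G`_i = (qre G`_i)%:A by apply: qconj_fixed; rewrite -coef_conjp hG.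
pose GC : {poly R[i]} := \poly_(i < size G) (qre G`_i)%:C%C.
have GE : map_poly quat_of_complex GC = G.
  apply/polyP => i; rewrite coef_map /= coef_poly; case: ltnP => h.
    by rewrite [RHS]Gre; apply: quatP => /=; ring.
  by rewrite raddf0 nth_default.
have [zs hzs] := closed_field_poly_normal GC.
have G0 : G != 0 by apply/negP => /eqP G0; have := hz 0; rewrite G0 lev0 normr0 eqxx => /(_ ler01).
have GC0 : GC != 0 by apply/negP => /eqP G0'; move: G0; rewrite -GE G0' map_poly0 eqxx.
exists (quat_of_complex (lead_coef GC)), [seq quat_of_complex t | t <- zs]; split.
- by rewrite fmorph_eq0 lead_coef_eq0.
- move=> _ /mapP[t tin ->]; rewrite ltNge; apply/negP => /hz /negP; apply.
  have rz : root GC t by rewrite hzs rootZ ?lead_coef_eq0 // root_prod_XsubC.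
  have : G.[quat_of_complex t] = 0 by rewrite -GE horner_map (rootP rz) rmorph0.
  rewrite horner_coef => <-; apply/eqP; apply: eq_bigr => i _.
  by rewrite Gre alg_comm.
- rewrite -GE {1}hzs -mul_polyC rmorphM /= map_polyC rmorph_prod big_map /=.
  by congr (_ * _); apply: eq_bigr => t _; rewrite rmorphB /= map_polyX map_polyC.
Qed.

Lemma coef_mul_trunc A y M n : (n < M)%N ->
  (A * \poly_(i < M) y i)`_n = reg_mul (fun k => A`_k) y n.
Proof.
move=> nM; rewrite coefM; apply: eq_bigr => i _.
by rewrite coef_poly (leq_ltn_trans (leq_subr _ _) nM).
Qed.

(** A given coefficient involves finitely many terms of [y], so this reduces to associativity in
    [{poly quat R}]. *)
Lemma reg_mul_polyM A B y n :
  reg_mul (fun k => (A * B)`_k) y n =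
  reg_mul (fun k => A`_k) (reg_mul (fun k => B`_k) y) n.
Proof.
rewrite -(@coef_mul_trunc _ _ n.+1) // -mulrA coefM; apply: eq_bigr => i _.
by rewrite coef_mul_trunc // ltnS leq_subr.
Qed.

Lemma reg_mul_polyC c y n : reg_mul (fun k => (c%:P)`_k) y n = c * y n.
Proof. by rewrite -(@coef_mul_trunc _ _ n.+1) // coefCM coef_poly ltnSn. Qed.

Definition abs_summable y := exists C : R, forall N, \sum_(n < N) `|y n| <= C.

Lemma abs_summable_poly A : abs_summable (fun n => A`_n).
Proof.
exists (\sum_(n < size A) `|A`_n|) => N.
have [h|h] := leqP N (size A).
  by rewrite (big_ord_widen _ (fun n => `|A`_n|) h) big_mkcond ler_sum // => i _; case: ifP.
rewrite (big_ord_widen _ (fun n => `|A`_n|) (ltnW h)) [leRHS]big_mkcond /= ler_sum // => i _.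
by case: ltnP => // hi; rewrite nth_default // normr0.
Qed.

(** If h = (X - z) y, then |z| |y_n| <= |h_n| + |y_(n-1)|; summing gives (|z| - 1) sum |y_n| <= sum
    |h_n|. *)
Lemma abs_summable_divXsubC z y : 1 < `|z| ->
  abs_summable (reg_mul (fun k => ('X - z%:P)`_k) y) -> abs_summable y.
Proof.
move=> z1 [C hC]; exists ((`|z| - 1)^-1 * C) => N.
rewrite ler_pdivlMl ?subr_gt0 // mulrBl mul1r lerBlDr.
have e0 : reg_mul (fun k => ('X - z%:P)`_k) y 0 = - (z * y 0).
  by rewrite /reg_mul big_ord1 coefB coefX coefC /= sub0r mulNr.
have eS n : reg_mul (fun k => ('X - z%:P)`_k) y n.+1 = y n - z * y n.+1.
  rewrite /reg_mul !big_ord_recl big1 => [|i _].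
    by rewrite !coefB !coefX !coefC /= sub0r subr0 mul1r addr0 mulNr addrC subn1.
  by rewrite coefB coefX coefC subr0 mul0r.
apply: (@le_trans _ _ (\sum_(n < N) `|reg_mul (fun k => ('X - z%:P)`_k) y n| +
    \sum_(n < N) `|y n|)); last by rewrite lerD2r.
case: N => [|N]; first by rewrite !big_ord0 mulr0 addr0.
rewrite mulr_sumr big_ord_recl [X in _ <= X + _]big_ord_recl /= e0 normrN qnormM -addrA lerD2l.
apply: (@le_trans _ _ (\sum_(i < N) `|reg_mul (fun k => ('X - z%:P)`_k) y i.+1| +
    \sum_(n < N) `|y n|)).
  rewrite -big_split /= ler_sum // => i _; rewrite eS -qnormM.
  by rewrite -{1}[z * _](subKr (y i)) (le_trans (ler_normB _ _)) // addrC.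
by rewrite lerD2l big_ord_recr /= lerDl.
Qed.

Lemma abs_summable_divprod (zs : seq (quat R)) y : (forall z, z \in zs -> 1 < `|z|) ->
  abs_summable (reg_mul (fun k => (\prod_(z <- zs) ('X - z%:P))`_k) y) -> abs_summable y.
Proof.
elim: zs y => [|z zs IH] y hz.
  rewrite big_nil => -[C hC]; exists C => N; move: (hC N).
  rewrite (eq_bigr (fun n : 'I_N => `|y n|)) // => i _.
  by rewrite reg_mul_polyC mul1r.
rewrite big_cons => -[C hC].
apply: IH => [w wzs|]; first by apply: hz; rewrite inE wzs orbT.
apply: (@abs_summable_divXsubC z); first by apply: hz; rewrite inE eqxx.
exists C => N; move: (hC N); congr (_ <= _).
by apply: eq_bigr => i _; rewrite reg_mul_polyM.
Qed.

(* [A^c * A] has real coefficients and its complex roots lie outside the closed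
   disc, so it can be divided out one linear factor at a time. *)
Lemma abs_summable_quotient A B y : (forall q, `|q| <= 1 -> lev q A != 0) ->
  (forall n, reg_mul (fun k => A`_k) y n = B`_n) -> abs_summable y.
Proof.
move=> hA hB.
have [|q q1|k [zs [k0 hzs GE]]] := @real_poly_factor (conjp A * A).
- by rewrite conjpM conjpK.
- by apply: lev_symmetrization_neq0 => w _ hw; rewrite hA // hw.
have [C hC] := abs_summable_poly (conjp A * B).
apply: (abs_summable_divprod hzs); exists (`|k|^-1 * C) => N.
rewrite ler_pdivlMl ?normr_gt0 //; apply: le_trans (hC N).
rewrite mulr_sumr ler_sum // => i _.
(* Multiplying A y = B on the left by [conjp A] makes [y] a quotient by the real polynomial
   [conjp A * A]. *)
have -> : (conjp A * B)`_i = reg_mul (fun k => (conjp A * A)`_k) y i.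
  by rewrite reg_mul_polyM coefM; apply: eq_bigr => j _; rewrite hB.
rewrite GE reg_mul_polyM -qnormM.
by rewrite reg_mul_polyC.
Qed.

End Decay.

(** * Positivity of truncated regular quotients *)

Section Positivity.
Variable R : realType.
Implicit Types (p q v w z : quat R) (A B : {poly quat R}) (y e : nat -> quat R).

Lemma abs_summable_small y (eps : R) : abs_summable y -> 0 < eps ->
  exists M, forall n, (M <= n)%N -> `|y n| <= eps.
Proof.
move=> [C hC] e0.
have h : cvgn (series (fun n => `|y n|)).
  apply: nondecreasing_is_cvgn.
    by apply/nondecreasing_seqP => n; rewrite seriesSr lerDl.
  by exists C => _ [n _ <-]; rewrite /series /= big_mkord.
have /cvgrPdist_le /(_ _ e0) [M _ hM] := cvg_series_cvg_0 h.
by exists M => n /hM /=; rewrite sub0r normrN normr_id.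
Qed.

(** Meant for the truncation error [A * Y - B]: its coefficients vanish below the truncation order
    [m], and at most [n] others remain. *)
Lemma normr_lev_le q A m n (K : R) : `|q| <= 1 -> (size A <= m + n)%N ->
  (forall i, (i < m)%N -> A`_i = 0) -> (forall i, `|A`_i| <= K) ->
  `|lev q A| <= n%:R * K.
Proof.
move=> q1 hs hm hK; rewrite (lev_widen _ hs) big_split_ord /= big1 ?add0r => [|i _]; last first.
  by rewrite hm ?mulr0.
apply: le_trans (ler_norm_sum _ _ _) _.
rewrite mulr_natl -[n in leRHS]card_ord -sumr_const ler_sum // => i _.
rewrite qnormM qnormX -[leRHS]mul1r ler_pM ?exprn_ge0 //.
by rewrite exprn_ile1.
Qed.

(* Conjugating by [A] on the sphere of [q] turns the regular quotient into a
   pointwise one, up to the truncation error. *)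
Lemma trunc_quotient_re_ge0 A B y (d : R) : 0 < d ->
  (forall q, `|q| <= 1 -> d <= qre (qconj (lev q A) * lev q B)) ->
  (forall n, reg_mul (fun k => A`_k) y n = B`_n) ->
  exists M0, forall M, (M0 <= M)%N -> forall q, `|q| <= 1 ->
    0 <= qre (lev q (\poly_(i < M) y i)).
Proof.
move=> d0 hd hB.
have hA q : `|q| <= 1 -> lev q A != 0.
  move=> /hd; apply: contraTneq => ->.
  by rewrite qconj0 mul0r -ltNge.
have sy := abs_summable_quotient hA hB.
set K := \sum_(j < size A) `|A`_j|.
have K0 : 0 <= K by apply: sumr_ge0.
set n := size A.
(* With coefficients of [y] below d / L, the truncation error changes the real part by at most K n K
   d / L <= d. *)
set L := 1 + K * (n%:R * K).
have L0 : 0 < L by rewrite ltr_wpDr // !mulr_ge0.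
have [M1 hM1] := abs_summable_small sy (divr_gt0 d0 L0).
(* A coefficient of [A * Y] of index at least [M] involves [y] at indices shifted down by less than
   [n], hence the margin [n] over [M1]; beyond [size B] only [A * Y] contributes. *)
exists (M1 + n + size B)%N => M hM q q1.
set Y := \poly_(i < M) y i.
have [q' [_ q'q hq']] : exists q', [/\ qre q' = qre q, `|q'| = `|q| & q' * lev q' A = lev q' A * q].
  by apply: lev_conjugate_onto => w _ wq; rewrite hA // wq.
have q'1 : `|q'| <= 1 by rewrite q'q.
have K_lev : `|lev q' A| <= K.
  apply: le_trans (ler_norm_sum _ _ _) _; apply: ler_sum => i _.
  by rewrite qnormM qnormX ler_piMl // exprn_ile1.
have hE : `|lev q' (A * Y - B)| <= n%:R * (K * (d / L)).
  apply: (@normr_lev_le _ _ M) => //.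
  - rewrite (leq_trans (size_polyD _ _)) // geq_max size_polyN; apply/andP; split.
      rewrite (leq_trans (size_polyMleq _ _)) // (leq_trans (leq_pred _)) //.
      by rewrite addnC leq_add2r size_poly.
    by rewrite (leq_trans _ (leq_addr _ _)) // (leq_trans _ hM) // leq_addl.
  - by move=> i iM; rewrite coefB coef_mul_trunc // hB subrr.
  - move=> i; have [iM|Mi] := ltnP i M.
      by rewrite coefB coef_mul_trunc // hB subrr normr0 mulr_ge0 // ltW // divr_gt0.
    rewrite coefB [X in _ - X]nth_default ?subr0; last first.
      by rewrite (leq_trans _ Mi) // (leq_trans _ hM) // leq_addl.
    rewrite coefM (le_trans (ler_norm_sum _ _ _)) // /K mulr_suml.
    have ni : (n <= i.+1)%N.
      by rewrite ltnW // ltnS (leq_trans _ Mi) // (leq_trans _ hM) // -addnA addnCA leq_addr.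
    rewrite (big_ord_widen _ (fun j => `|A`_j| * (d / L)) ni) [leRHS]big_mkcond.
    apply: ler_sum => j _; case: ltnP => jn; last by rewrite nth_default ?mul0r ?normr0.
    rewrite qnormM ler_wpM2l // coef_poly; case: ifP => _; last by rewrite normr0 ltW // divr_gt0.
    apply: hM1; rewrite leq_subRL; last by rewrite -ltnS.
    rewrite (leq_trans _ Mi) // (leq_trans _ hM) // addnC -addnA leq_add2l.
    by rewrite (leq_trans (ltnW jn)) // leq_addr.
(* The choice of [q'] makes the value of [A * Y] at [q'] equal to [lev q' A * lev q Y], so the
   hypothesis at [q'] yields information at [q]. *)
have : 0 <= `|lev q' A| ^+ 2 * qre (lev q Y).
  have /qre_conjmul_sqn <- : lev q' A * lev q Y = lev q' B + lev q' (A * Y - B).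
    by rewrite -levD addrC subrK (lev_mul _ hq').
  rewrite mulrDr qreD -[X in _ + X]opprK subr_ge0.
  apply: le_trans (hd _ q'1); rewrite lerNl.
  apply: lerNnormlW; apply: le_trans (normr_qre _) _.
  rewrite qnormM qnorm_conj (le_trans (ler_pM _ _ K_lev hE)) //.
  rewrite !mulrA ler_pdivrMr // /L; lra.
rewrite pmulr_rge0 // exprn_gt0 // normr_gt0; exact: hA.
Qed.

End Positivity.

(** * Averages over roots of unity *)

Section Averaging.
Variable R : realType.
Implicit Types (p q v w z I : quat R) (y : nat -> quat R) (th b : R).

(** The exponential of [th] times [I] in the slice of [I]. *)
Definition cis I th : quat R := slice_pt I (cos th) (sin th).

Lemma imag_sphere_sqr I : imag_sphere I -> I * I = -1.
Proof. by rewrite /imag_sphere /= expr2. Qed.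

Lemma cisD I th b : imag_sphere I -> cis I (th + b) = cis I th * cis I b.
Proof.
move=> /imag_sphere_sqr hI; rewrite /cis /slice_pt cosD sinD.
have -> : ((cos th)%:A + sin th *: I) * ((cos b)%:A + sin b *: I) =
    (cos th * cos b)%:A + (cos th * sin b) *: I +
    ((sin th * cos b) *: I - (sin th * sin b)%:A).
  rewrite mulrDl !mulrDr !mulr_algl -!scalerAl -!scalerAr mulr1 hI.
  by rewrite !scalerA scalerN.
by rewrite scalerBl scalerDl [X in _ + X = _]addrC addrACA [X in _ + X = _]addrC.
Qed.

Lemma cis0 I : cis I 0 = 1.
Proof. by rewrite /cis /slice_pt cos0 sin0 scale1r scale0r addr0. Qed.

Lemma cisMn I th n : imag_sphere I -> cis I (n%:R * th) = cis I th ^+ n.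
Proof.
move=> hI; elim: n => [|n IH]; first by rewrite mul0r cis0.
by rewrite -natr1 mulrDl mul1r cisD // IH exprSr.
Qed.

Lemma normr_cis I th : imag_sphere I -> `|cis I th| = 1.
Proof.
move=> /sqr_eqN1P[I0 I1]; rewrite qnormE.
suff -> : qsqn (cis I th) = 1 by rewrite sqrtr1.
have := cos2Dsin2 th; move: I0 I1; case: I => a1 b1 c1 d1; rewrite /qsqn /= => -> h1 h2.
have h3 : b1 ^+ 2 + c1 ^+ 2 + d1 ^+ 2 = 1 by move: h1; rewrite expr0n /= add0r.
transitivity (cos th ^+ 2 + sin th ^+ 2 * (b1 ^+ 2 + c1 ^+ 2 + d1 ^+ 2)); first by ring.
by rewrite h3 mulr1.
Qed.

Lemma qre_cis_mul I th q : imag_sphere I ->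
  qre (cis I th * q) = cos th * qre q + sin th * qre (I * q).
Proof. by move=> _; rewrite mulrDl mulr_algl -scalerAl. Qed.

Lemma unit_quat_cis q : `|q| = 1 -> exists I th, imag_sphere I /\ q = cis I th.
Proof.
move=> q1; exists (slice_unit q), (acos (qre q)); split; first exact: slice_unit_sphere.
have r1 : -1 <= qre q <= 1 by rewrite -ler_norml -q1 normr_qre.
rewrite /cis /slice_pt acosK ?in_itv //= sin_acos //.
have -> : Num.sqrt (1 - qre q ^+ 2) = `|qim q|.
  rewrite qnormE; congr Num.sqrt; have : qsqn q = 1 by rewrite qsqnE q1 expr1n.
  by rewrite /qsqn /= => <-; ring.
by rewrite slice_unitE; apply: quatP => /=; ring.
Qed.

Lemma cos_lt1 th : 0 < th < 2 * pi -> cos th < 1.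
Proof.
move=> /andP[t0 t1]; have -> : th = (th / 2) *+ 2 by rewrite -mulr_natr; field.
rewrite cos_mulr2n cos2sin2 ltrBlDr -mulr2n ltrMn2r /= ltrBlDr ltrDl.
by apply/exprn_gt0/sin_gt0_pi; rewrite divr_gt0 //= ltr_pdivrMr // mulrC.
Qed.

(** * Discrete orthogonality of cosines and sines *)

Section Orthogonality.
Variable N : nat.
Hypothesis N0 : (0 < N)%N.
Let step : R := 2 * pi / N%:R.
Let ph (j : nat) : R := j%:R * step.

(** A geometric sum over the powers of an [N]-th root of unity, which differs from 1 because 0 < l <
    N. *)
Lemma sum_cis l : (0 < l < N)%N -> forall I, imag_sphere I ->
  \sum_(j < N) cis I (l%:R * ph j) = 0.
Proof.
move=> /andP[l0 lN] I hI.
have e j : cis I (l%:R * ph j) = cis I (l%:R * step) ^+ j.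
  by rewrite -cisMn // /ph; congr cis; rewrite mulrCA.
under eq_bigr do rewrite e.
have NR : (N%:R : R) != 0 by rewrite pnatr_eq0 -lt0n.
have : (cis I (l%:R * step) - 1) * \sum_(j < N) cis I (l%:R * step) ^+ j = 0.
  rewrite -subrX1 -cisMn //.
  have -> : N%:R * (l%:R * step) = l%:R * (2 * pi) by rewrite /step; field.
  rewrite cisMn // /cis mulr_natl cos2pi sin2pi /slice_pt scale1r scale0r addr0.
  by rewrite expr1n subrr.
move=> /eqP; rewrite qmul_eq0 => /orP[|/eqP //].
rewrite subr_eq0 => /eqP /(congr1 (@qre R)).
have [I0 _] := sqr_eqN1P hI.
rewrite /cis qre_slice_pt //= => h.
suff : cos (l%:R * step) < 1 by rewrite h ltxx.
have P0 := pi_gt0 R; have NR0 : 0 < N%:R :> R by rewrite ltr0n.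
apply: cos_lt1; rewrite /step !mulr_gt0 ?ltr0n ?invr_gt0 //=.
rewrite mulrA ltr_pdivrMr // mulrC ltr_pM2l ?mulr_gt0 //.
by rewrite ltr_nat.
Qed.

Lemma sum_cos_sin l : (0 < l < N)%N ->
  \sum_(j < N) cos (l%:R * ph j) = 0 /\ \sum_(j < N) sin (l%:R * ph j) = 0.
Proof.
move=> hl; have hI := slice_unit_sphere (0 : quat R).
have := sum_cis hl hI; set I := slice_unit 0.
rewrite /cis /slice_pt big_split /= -!scaler_suml => h.
have [I0 I1] := sqr_eqN1P hI.
have c0 : \sum_(j < N) cos (l%:R * ph j) = 0.
  by have := congr1 (@qre R) h; rewrite /= I0 mulr0 addr0 mulr1.
split=> //; move/eqP: h; rewrite c0 scale0r add0r scaler_eq0 => /orP[/eqP//|/eqP h].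
by move: I1; rewrite -/I h /qsqn /= expr0n /= !addr0 => /eqP; rewrite eq_sym oner_eq0.
Qed.

Lemma sum_sin l : (l < N)%N -> \sum_(j < N) sin (l%:R * ph j) = 0.
Proof.
case: l => [_|l lN]; last by have [] := @sum_cos_sin l.+1 lN.
by rewrite big1 // => j _; rewrite mul0r sin0.
Qed.

(** The product becomes a sum of cosines of frequencies k + m and |m - k|. The bound k + m < N
    prevents aliasing, so only frequency 0 survives: twice if k = m = 0, once if k = m > 0. *)
Lemma sum_cos_cos k m : (k + m < N)%N ->
  \sum_(j < N) cos (k%:R * ph j) * cos (m%:R * ph j) =
  if k == m then (if k == 0%N then N%:R else N%:R / 2) else 0.
Proof.
wlog km : k m / (k <= m)%N => [hw kmN|kmN].
  have [/hw->//|/ltnW/hw h] := leqP k m.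
  under eq_bigr do rewrite mulrC.
  by rewrite h 1?addnC // [m == k]eq_sym; case: eqVneq => // ->.
have e j : cos (k%:R * ph j) * cos (m%:R * ph j) =
    2^-1 * (cos ((k + m)%:R * ph j) + cos ((m - k)%:R * ph j)).
  by rewrite natrB // natrD mulrDl mulrBl cosD cosB; field.
under eq_bigr do rewrite e.
rewrite -mulr_sumr big_split /=.
have z0 : \sum_(j < N) cos (0%:R * ph j) = N%:R.
  by under eq_bigr do rewrite mul0r cos0; rewrite sumr_const card_ord.
have [kEm|kNm] := eqVneq k m.
  rewrite -kEm subnn z0; have [->|k0] := eqVneq k 0%N; first by rewrite z0; field.
  have kk : (0 < k + k < N)%N by move: kmN; rewrite -kEm addn_gt0 lt0n k0.
  by have [-> _] := sum_cos_sin kk; rewrite add0r mulrC.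
have km' : (k < m)%N by rewrite ltn_neqAle kNm.
have skm : (0 < k + m < N)%N by rewrite kmN addn_gt0 (leq_ltn_trans _ km') ?orbT.
have dkm : (0 < m - k < N)%N.
  by rewrite subn_gt0 km' (leq_ltn_trans (leq_subr _ _)) // (leq_ltn_trans _ kmN) // leq_addl.
by have [-> _] := sum_cos_sin skm; have [-> _] := sum_cos_sin dkm; rewrite addr0 mulr0.
Qed.

Lemma sum_cos_sin_mul k m : (k + m < N)%N ->
  \sum_(j < N) cos (k%:R * ph j) * sin (m%:R * ph j) = 0.
Proof.
move=> kmN.
have e j : cos (k%:R * ph j) * sin (m%:R * ph j) =
    2^-1 * (sin ((k + m)%:R * ph j) + sin ((m%:R - k%:R) * ph j)).
  by rewrite natrD mulrDl mulrBl sinD sinB; field.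
under eq_bigr do rewrite e.
rewrite -mulr_sumr big_split /= sum_sin // add0r.
have [km|/ltnW mk] := leqP k m.
  under eq_bigr do rewrite -(natrB _ km).
  rewrite sum_sin ?mulr0 // (leq_ltn_trans (leq_subr _ _)) // (leq_ltn_trans _ kmN) // leq_addl //.
have e' j : sin ((m%:R - k%:R) * ph j) = - sin ((k - m)%:R * ph j).
  by rewrite natrB // -sinN -mulNr opprB.
under eq_bigr do rewrite e'.
rewrite sumrN sum_sin ?oppr0 ?mulr0 //.
by rewrite (leq_ltn_trans (leq_subr _ _)) // (leq_ltn_trans _ kmN) // leq_addr.
Qed.

(** A discrete Fourier extraction on the unit circle of one slice: the m-th term has real part cos(m
    phi) Re(v) + sin(m phi) Re(I v) with v = [cis I b ^+ m * y m], and orthogonality isolates m =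
    k. *)
Lemma average_cos y M k I b : imag_sphere I -> (k < M)%N -> (M + M <= N)%N ->
  \sum_(j < N) cos (k%:R * ph j) * qre (lev (cis I (ph j + b)) (\poly_(i < M) y i)) =
  (if k == 0%N then N%:R else N%:R / 2) * qre (cis I b ^+ k * y k).
Proof.
move=> hI kM MN.
pose C m := qre (cis I b ^+ m * y m).
pose S m := qre (I * (cis I b ^+ m * y m)).
have e j : qre (lev (cis I (ph j + b)) (\poly_(i < M) y i)) =
   \sum_(m < M) (cos (m%:R * ph j) * C m + sin (m%:R * ph j) * S m).
  rewrite (@lev_widen _ _ _ M) ?size_poly // qre_sum; apply: eq_bigr => m _.
  by rewrite coef_poly ltn_ord -cisMn // mulrDr cisD // -mulrA qre_cis_mul // cisMn.
rewrite -/(C k); under eq_bigr do rewrite e mulr_sumr.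
rewrite exchange_big /= (bigD1 (Ordinal kM)) //= [X in _ + X]big1 ?addr0 => [|m mk].
  under eq_bigr do rewrite mulrDr (mulrA (cos _) (cos _)) (mulrA (cos _) (sin _)).
  rewrite big_split /= -!mulr_suml sum_cos_cos ?sum_cos_sin_mul ?eqxx ?mul0r ?addr0 //;
  by rewrite (leq_trans _ MN) // -addSn leq_add // ltnW.
under eq_bigr do rewrite mulrDr (mulrA (cos _) (cos _)) (mulrA (cos _) (sin _)).
have kmN : (k + m < N)%N by rewrite (leq_trans _ MN) // -addSn leq_add // ltnW.
rewrite big_split /= -!mulr_suml sum_cos_cos // sum_cos_sin_mul // !mul0r addr0.
case: eqP => [E|]; last by rewrite mul0r.
by move/eqP: mk; case; apply: val_inj.
Qed.

End Orthogonality.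

(** Since 1 - cos(2x) = 2 sin(x)^2, this is |sin(n x)| <= n |sin x| at the half angle. It makes the
    second averaging weight below nonnegative. *)
Lemma one_sub_cosMn n th : 1 - cos (n%:R * th) <= n%:R ^+ 2 * (1 - cos th).
Proof.
have hs (x : R) : `|sin (n%:R * x)| <= n%:R * `|sin x|.
  elim: n => [|n IH]; first by rewrite !mul0r sin0 normr0.
  rewrite -natr1 mulrDl mul1r sinD (le_trans (ler_normD _ _)) // !normrM mulrDl mul1r lerD //.
    by rewrite (le_trans _ IH) // ler_piMr // cos_max.
  by rewrite ler_piMl // cos_max.
have hc (x : R) : 1 - cos (x *+ 2) = 2 * sin x ^+ 2.
  by rewrite cos_mulr2n cos2sin2; ring.
have -> : th = (th / 2) *+ 2 by rewrite -mulr_natr; field.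
rewrite mulrnAr !hc; have := hs (th / 2); set s := sin _; set t := sin (th / 2) => h.
have : `|s| ^+ 2 <= (n%:R * `|t|) ^+ 2 by rewrite ler_pXn2r ?nnegrE ?mulr_ge0.
rewrite exprMn !real_normK ?num_real //; lra.
Qed.

(* Average against the weight [1 - cos (n phi)], on a circle rotated by an [n]-th
   root of [w]. *)
Lemma positive_trunc_coef y M w n : (forall q, `|q| = 1 -> 0 <= qre (lev q (\poly_(i < M) y i))) ->
  (0 < n < M)%N -> `|w| = 1 -> 0 <= qre (y 0%N) - 2^-1 * qre (w * y n).
Proof.
move=> hy /andP[n0 nM] /unit_quat_cis [I [b [hI wE]]].
have M0 : (0 < M)%N by apply: leq_ltn_trans nM.
have N0 : (0 < M + M)%N by rewrite addn_gt0 M0.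
have NR : 0 < (M + M)%:R :> R by rewrite ltr0n.
have n0R : n%:R != 0 :> R by rewrite pnatr_eq0 -lt0n.
have E0 := average_cos N0 y (b / n%:R) hI M0 (leqnn _).
have En := average_cos N0 y (b / n%:R) hI nM (leqnn _).
rewrite -(pmulr_rge0 _ NR).
move: En E0; rewrite -cisMn // mulrCA divff // mulr1 -wE expr0 mul1r eqxx.
rewrite (negbTE (lt0n_neq0 n0)) => En E0.
have -> : (M + M)%:R * (qre (y 0%N) - 2^-1 * qre (w * y n)) =
   (M + M)%:R * qre (y 0%N) - (M + M)%:R / 2 * qre (w * y n) by field.
rewrite -E0 -En -sumrB; apply: sumr_ge0 => j _.
rewrite mul0r cos0 mul1r -{1}[qre _]mul1r -mulrBl mulr_ge0 ?subr_ge0 ?cos_le1 //.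
by rewrite hy // normr_cis.
Qed.

(* Average against the weight [n^2 (1 - cos phi) - (1 - cos (n phi))]. *)
Lemma positive_trunc_coef1 y M w n : (forall q, `|q| = 1 -> 0 <= qre (lev q (\poly_(i < M) y i))) ->
  (0 < n < M)%N -> `|w| = 1 ->
  qre (y 0%N) - 2^-1 * qre (w ^+ n * y n) <=
  n%:R ^+ 2 * (qre (y 0%N) - 2^-1 * qre (w * y 1%N)).
Proof.
move=> hy /andP[n0 nM] /unit_quat_cis [I [b [hI wE]]].
have M0 : (0 < M)%N by apply: leq_ltn_trans nM.
have M1 : (1 < M)%N by apply: leq_ltn_trans nM.
have N0 : (0 < M + M)%N by rewrite addn_gt0 M0.
have NR : 0 < (M + M)%:R :> R by rewrite ltr0n.
have E0 := average_cos N0 y b hI M0 (leqnn _).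
have E1 := average_cos N0 y b hI M1 (leqnn _).
have En := average_cos N0 y b hI nM (leqnn _).
move: E1 En E0; rewrite -wE expr0 expr1 mul1r /= (negbTE (lt0n_neq0 n0)) => E1 En E0.
rewrite -(ler_pM2l NR).
have -> : (M + M)%:R * (qre (y 0%N) - 2^-1 * qre (w ^+ n * y n)) =
   (M + M)%:R * qre (y 0%N) - (M + M)%:R / 2 * qre (w ^+ n * y n) by field.
have -> : (M + M)%:R * (n%:R ^+ 2 * (qre (y 0%N) - 2^-1 * qre (w * y 1%N))) =
   n%:R ^+ 2 * ((M + M)%:R * qre (y 0%N) - (M + M)%:R / 2 * qre (w * y 1%N)) by field.
rewrite -E0 -En -E1 -!sumrB mulr_sumr; apply: ler_sum => j _.
rewrite !mul0r cos0 -!mulrBl [leRHS]mulrA [1 * (_ * _)]mul1r ler_wpM2r ?one_sub_cosMn //.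
by rewrite hy // normr_cis.
Qed.

End Averaging.

(** * Coefficients of regular functions with positive real part *)

Section Caratheodory.
Variable R : realType.
Implicit Types (q u v w z : quat R) (c d p : nat -> quat R).

Lemma reg_mul_recl c p n :
  reg_mul c p n = c 0%N * p n + \sum_(k < n) c k.+1 * p (n - k.+1)%N.
Proof. by rewrite /reg_mul big_ord_recl subn0. Qed.

(** Course-of-values recursion: the list stores all earlier coefficients of the quotient. No
    division occurs because the constant coefficient of [c] will be 1. *)
Fixpoint quot_seq c d n : seq (quat R) :=
  if n is m.+1 then
    rcons (quot_seq c d m)
      (d m - \sum_(k < m) c k.+1 * (quot_seq c d m)`_(m - k.+1))
  else [::].

Lemma size_quot_seq c d n : size (quot_seq c d n) = n.
Proof. by elim: n => //= n IH; rewrite size_rcons IH. Qed.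

Lemma nth_quot_seq c d n k : (k < n)%N ->
  (quot_seq c d n)`_k = (quot_seq c d k.+1)`_k.
Proof.
elim: n => // n IH; rewrite ltnS leq_eqVlt => /orP[/eqP -> //|kn].
by rewrite [quot_seq c d n.+1]/= nth_rcons size_quot_seq kn IH.
Qed.

Lemma reg_quotient_exists c d : c 0%N = 1 -> exists p, forall n, reg_mul c p n = d n.
Proof.
move=> c0; exists (fun n => (quot_seq c d n.+1)`_n) => n.
rewrite reg_mul_recl c0 mul1r [quot_seq _ _ _]/= nth_rcons size_quot_seq ltnn eqxx.
rewrite -[RHS](subrK (\sum_(k < n) c k.+1 * (quot_seq c d n)`_(n - k.+1))).
congr (_ + _); apply: eq_bigr => k _; rewrite [in RHS]nth_quot_seq //.
by rewrite ltn_subrL /= (leq_ltn_trans _ (ltn_ord k)).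
Qed.

(** The recursion for a quotient coefficient only looks at indices up to its own, so truncation at
    [N] is invisible below [N]; the real factor [t] is central, so dilation passes through the
    recursion. *)
Lemma reg_quotient_dilate (t : R) c d p c' d' p' N : c 0%N = 1 -> c' 0%N = 1 ->
  (forall n, reg_mul c p n = d n) -> (forall n, reg_mul c' p' n = d' n) ->
  (forall k, (k < N)%N -> c' k = t ^+ k *: c k /\ d' k = t ^+ k *: d k) ->
  forall k, (k < N)%N -> p' k = t ^+ k *: p k.
Proof.
move=> c0 c'0 hp hp' hN; elim/ltn_ind => n IH nN.
have := hp' n; have [_ ->] := hN n nN; rewrite -hp !reg_mul_recl c0 c'0 !mul1r.
rewrite scalerDr => E; apply: (addIr (\sum_(k < n) c' k.+1 * p' (n - k.+1)%N)).
rewrite E; congr (_ + _); rewrite scaler_sumr; apply: eq_bigr => k _.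
have kn : (k.+1 <= n)%N by [].
have [-> _] := hN k.+1 (leq_ltn_trans kn nN).
rewrite IH; last 2 first.
- by rewrite ltn_subrL /= (leq_ltn_trans _ (ltn_ord k)).
- by rewrite (leq_ltn_trans (leq_subr _ _)).
by rewrite -scalerAl -scalerAr scalerA -exprD subnKC.
Qed.

Lemma ge0_at1 (f : R -> R) : {for 1, continuous f} ->
  (forall t, 0 < t < 1 -> 0 <= f t) -> 0 <= f 1.
Proof.
move=> cf hf; rewrite leNgt; apply/negP => f1.
have /nbhs_ballP[e /= e0 he] : \forall x \near (1 : R), f x < 0.
  exact: (cvgr_lt _ cf).
(* The maximum with 1/2 keeps [t] positive when [e] is large. *)
pose t : R := Num.max (1 / 2) (1 - e / 2).
have : f t < 0.
  apply: he; rewrite /ball /= /t ltr_distl.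
  by case: (leP (1 / 2) (1 - e / 2)) => h; apply/andP; split; lra.
have : 0 <= f t.
  by apply: hf; rewrite /t; case: (leP (1 / 2) (1 - e / 2)) => h; apply/andP; split; lra.
by move=> /le_lt_trans h /h; rewrite ltxx.
Qed.

(** A condition on polynomials only: the margin [e] is what absorbs truncation errors of the
    quotient, and [n < N] keeps the coefficient under study inside the truncation. *)
Definition dilation_positive c d := forall (t : R), 0 < t < 1 -> forall n, exists N (e : R),
  [/\ (n < N)%N, 0 < e & forall q, `|q| <= 1 ->
   e <= qre (qconj (\sum_(k < N) q ^+ k * (t ^+ k *: c k)) *
                   \sum_(k < N) q ^+ k * (t ^+ k *: d k))].

Lemma dilation_positive_trunc c d p : c 0%N = 1 -> (forall n, reg_mul c p n = d n) ->
  dilation_positive c d -> forall t : R, 0 < t < 1 -> forall n, exists y M,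
  [/\ (n < M)%N, forall k, (k <= n)%N -> y k = t ^+ k *: p k &
    forall q, `|q| = 1 -> 0 <= qre (lev q (\poly_(i < M) y i))].
Proof.
move=> c0 hp hpos t t01 n; have [N [e [nN e0 hN]]] := hpos t t01 n.
pose A : {poly quat R} := \poly_(k < N) (t ^+ k *: c k).
pose B : {poly quat R} := \poly_(k < N) (t ^+ k *: d k).
have N0 : (0 < N)%N by apply: leq_ltn_trans nN.
have A0 : A`_0 = 1 by rewrite coef_poly N0 expr0 scale1r.
have [y hy] := @reg_quotient_exists (fun k => A`_k) (fun k => B`_k) A0.
have levP a q : lev q (\poly_(k < N) (t ^+ k *: a k)) = \sum_(k < N) q ^+ k * (t ^+ k *: a k).
  rewrite (lev_widen _ (size_poly _ _)); apply: eq_bigr => k _.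
  by rewrite coef_poly ltn_ord.
have [|M0 hM0] := @trunc_quotient_re_ge0 _ A B y e e0 _ hy.
  by move=> q q1; rewrite !levP hN.
exists y, (maxn M0 n.+1); split.
- by rewrite leq_max ltnSn orbT.
- move=> k kn; apply: (reg_quotient_dilate c0 A0 hp hy (N := N)); last exact: leq_ltn_trans nN.
  by move=> j jN; rewrite !coef_poly jN.
- by move=> q q1; apply: hM0; rewrite ?leq_maxl ?q1.
Qed.

(** For 0 < t < 1 both averaging inequalities hold for the dilated coefficients t^k p_k; they are
    polynomial in [t], so they persist at t = 1. *)
Lemma caratheodory_functional c d p w n : c 0%N = 1 -> d 0%N = 1 ->
  (forall n, reg_mul c p n = d n) -> dilation_positive c d ->
  (0 < n)%N -> `|w| = 1 ->
  0 <= 1 - 2^-1 * qre (w * p n) /\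
  1 - 2^-1 * qre (w ^+ n * p n) <= n%:R ^+ 2 * (1 - 2^-1 * qre (w * p 1%N)).
Proof.
move=> c0 d0 hp hpos n0 w1.
have p0 : p 0%N = 1 by have := hp 0; rewrite /reg_mul big_ord1 c0 d0 mul1r.
have yP t : 0 < t < 1 -> 0 <= 1 - 2^-1 * (t ^+ n * qre (w * p n)) /\
  1 - 2^-1 * (t ^+ n * qre (w ^+ n * p n)) <= n%:R ^+ 2 * (1 - 2^-1 * (t * qre (w * p 1%N))).
  move=> t01; have [y [M [nM hy hM]]] := dilation_positive_trunc c0 hp hpos t01 n.
  have nM' : (0 < n < M)%N by rewrite n0.
  have := positive_trunc_coef hM nM' w1; have := positive_trunc_coef1 hM nM' w1.
  by rewrite !hy // p0 expr0 scale1r -[w ^+ n * _]scalerAr -![w * _]scalerAr !qreZ expr1.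
have cX (k : nat) : {for 1, continuous (fun t : R => t ^+ k)} by exact: exprn_continuous.
split.
  have := @ge0_at1 (fun t => 1 - 2^-1 * (t ^+ n * qre (w * p n))).
  rewrite expr1n mul1r; apply; last by move=> t /yP[].
  by apply: cvgB; [exact: cvg_cst|apply: cvgMl_tmp; apply: cvgMr_tmp; exact: cX].
rewrite -subr_ge0.
have := @ge0_at1 (fun t => n%:R ^+ 2 * (1 - 2^-1 * (t * qre (w * p 1%N))) -
  (1 - 2^-1 * (t ^+ n * qre (w ^+ n * p n)))).
rewrite expr1n !mul1r; apply; last by move=> t /yP[_]; rewrite subr_ge0.
apply: cvgB; last by apply: cvgB; [exact: cvg_cst|apply: cvgMl_tmp; apply: cvgMr_tmp; exact: cX].
by apply: cvgMl_tmp; apply: cvgB; [exact: cvg_cst|apply: cvgMl_tmp; apply: cvgMr_tmp].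
Qed.

Lemma caratheodory_le2 c d p n : c 0%N = 1 -> d 0%N = 1 ->
  (forall n, reg_mul c p n = d n) -> dilation_positive c d -> (0 < n)%N -> `|p n| <= 2.
Proof.
move=> c0 d0 hp hpos n0; have [->|pn0] := eqVneq (p n) 0; first by rewrite normr0.
have N0 : `|p n| != 0 by rewrite normr_eq0.
(* This unit quaternion rotates [p n] onto its modulus. *)
have w1 : `|(`|p n|^-1 *: qconj (p n) : quat R)| = 1.
  by rewrite normrZ qnorm_conj ger0_norm ?invr_ge0 // mulVf.
have [h _] := caratheodory_functional c0 d0 hp hpos n0 w1.
move: h; rewrite -scalerAl qconj_mul qreZ qre_alg expr2 mulKf //; lra.
Qed.

(** For w = conj(u) the right side of the second inequality vanishes, so Re(conj(u^n) p_n) >= 2.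
    With |p_n| <= 2, expanding |2 u^n - p_n|^2 shows that it is at most 0. *)
Lemma caratheodory_eq2 c d p n : c 0%N = 1 -> d 0%N = 1 ->
  (forall n, reg_mul c p n = d n) -> dilation_positive c d -> (0 < n)%N ->
  `|p 1%N| = 2 -> p n = 2 *: (2^-1 *: p 1%N) ^+ n.
Proof.
move=> c0 d0 hp hpos n0 p1; set u := 2^-1 *: p 1%N.
have u1 : `|u| = 1 by rewrite normrZ p1 ger0_norm // mulVf.
have w1 : `|qconj u| = 1 by rewrite qnorm_conj.
have [_ h] := caratheodory_functional c0 d0 hp hpos n0 w1.
have pn2 := caratheodory_le2 c0 d0 hp hpos n0.
have p1E : p 1%N = 2 *: u by rewrite scalerA divff // scale1r.
move: h; rewrite p1E -scalerAr qconj_mul u1 expr1n qreZ qre_alg mulr1 mulVf // subrr mulr0.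
rewrite -qconjX => h.
apply/eqP; rewrite eq_sym -subr_eq0 -normr_eq0 -sqrf_eq0 eq_le sqr_ge0 andbT.
rewrite qnormB_sqr normrZ qnormX u1 expr1n mulr1 ger0_norm //.
have -> : qconj (2 *: u ^+ n) = 2 *: qconj (u ^+ n) by apply: quatP => /=; ring.
rewrite -scalerAl qreZ.
have : `|p n| ^+ 2 <= 2 ^+ 2 by rewrite ler_pXn2r ?nnegrE.
by move: h; move: (qre _) => x; lra.
Qed.

(** * Coefficient bounds from the starlike recurrence *)

Section Growth.
Variables c p : nat -> quat R.
Hypothesis c0 : c 0%N = 1.
Hypothesis hp : forall n, reg_mul c p n = n.+1%:R *: c n.

Lemma starlike_rec n : n%:R *: c n = \sum_(k < n) c k * p (n - k)%N.
Proof.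
have p0 : p 0%N = 1 by have := hp 0; rewrite /reg_mul big_ord1 c0 mul1r scale1r.
apply: (addIr (c n)); rewrite -[in LHS](scale1r (c n)) scalerA mulr1 -scalerDl natr1.
by rewrite -hp /reg_mul big_ord_recr /= subnn p0 mulr1.
Qed.

Hypothesis p2 : forall n, (0 < n)%N -> `|p n| <= 2.

Let sum_nat n : \sum_(k < n) (k.+1%:R * 2 : R) = n%:R * n.+1%:R.
Proof.
elim: n => [|n IH]; first by rewrite big_ord0 mul0r.
by rewrite big_ord_recr /= IH -!natr1; ring.
Qed.

Lemma starlike_coef_le n : `|c n| <= n.+1%:R.
Proof.
elim/ltn_ind: n => -[_|n IH]; first by rewrite c0 qnorm1.
rewrite -(ler_pM2l (ltr0Sn R n)) -[X in X * `|_|]ger0_norm // -normrZ starlike_rec -sum_nat.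
apply: le_trans (ler_norm_sum _ _ _) _; apply: ler_sum => k _.
by rewrite qnormM ler_pM ?IH // p2 // subn_gt0.
Qed.

(** The last term of the recurrence is the one that carries [p 1]; were its norm below 2, the growth
    estimate would be strict. *)
Lemma starlike_coef_eq n : (0 < n)%N -> `|c n| = n.+1%:R -> `|p 1%N| = 2.
Proof.
case: n => // n _ hn; apply/le_anti; rewrite p2 //= leNgt; apply/negP => h.
suff : `|c n.+1| < n.+2%:R by rewrite hn ltxx.
rewrite -(ltr_pM2l (ltr0Sn R n)) -[X in X * `|_|]ger0_norm // -normrZ starlike_rec -sum_nat.
apply: le_lt_trans (ler_norm_sum _ _ _) _; rewrite !big_ord_recr /=.
apply: ler_ltD.
  apply: ler_sum => k _; rewrite qnormM ler_pM ?starlike_coef_le // p2 // subn_gt0.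
  by rewrite ltnW // ltnS.
rewrite qnormM subSnn; apply: le_lt_trans (_ : n.+1%:R * `|p 1%N| < _).
  by rewrite ler_wpM2r // starlike_coef_le.
by rewrite ltr_pM2l.
Qed.

Lemma starlike_coef_extremal u : (forall n, (0 < n)%N -> p n = 2 *: u ^+ n) ->
  forall n, c n = n.+1%:R *: u ^+ n.
Proof.
move=> hu; elim/ltn_ind => -[_|n IH]; first by rewrite c0 expr0 scale1r.
apply: (scalerI (a := n.+1%:R)); first by rewrite pnatr_eq0.
rewrite starlike_rec (eq_bigr (fun k : 'I_n.+1 => (k.+1%:R * 2) *: u ^+ n.+1)) => [|k _].
  by rewrite -scaler_suml sum_nat scalerA.
rewrite IH // hu ?subn_gt0 // -scalerAl -scalerAr scalerA -exprD subnKC // ltnW //.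
Qed.

End Growth.
End Caratheodory.

(** * Power series on the ball *)

Section Series.
Variable R : realType.
Implicit Types (q u v w z : quat R) (a c d p : nat -> quat R).

Definition psum a q : nat -> quat R := fun N => \sum_(n < N) q ^+ n * a n.

(** Radius of convergence at least 1, in terms of Abel's criterion. *)
Definition tempered a := forall r : R, 0 <= r < 1 -> exists B : R,
  forall n, `|a n| * r ^+ n <= B.

Lemma cvg_tempered a (F : quat R -> quat R) :
  (forall q, unit_ball q -> psum a q @ \oo --> F q) -> tempered a.
Proof.
move=> h r /andP[r0 r1].
have rb : unit_ball (r%:A : quat R) by rewrite /unit_ball /= qnorm_alg ger0_norm.
have /cvgP : series (fun n => (r%:A : quat R) ^+ n * a n) @ \oo --> F r%:A.
  by have := h _ rb; apply: cvg_trans; apply: near_eq_cvg; near=> N; rewrite /series /= big_mkord.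
move=> /cvg_series_cvg_0 /cvgP /cvg_seq_bounded [M [_ hM]].
exists (M + 1) => n.
have := hM (M + 1) _ n I; rewrite ltrDl ltr01 => /(_ isT) /=.
by rewrite qnormM qnormX qnorm_alg ger0_norm // mulrC.
Unshelve. all: by end_near. Qed.

(** Boundedness at the larger radius s = (1 + r) / 2 gives decay at [r] with ratio r / s. *)
Lemma tempered_geometric a (r : R) : tempered a -> 0 <= r < 1 ->
  exists B x : R, [/\ 0 <= B, 0 <= x < 1 & forall n, `|a n| * r ^+ n <= B * x ^+ n].
Proof.
move=> ha /andP[r0 r1]; pose s := (1 + r) / 2.
have s01 : 0 <= s < 1 by apply/andP; split; rewrite /s; lra.
have s0 : 0 < s by rewrite /s; lra.
have [B hB] := ha s s01.
have B0 : 0 <= B by apply: le_trans (hB 0); rewrite mulr_ge0 // exprn_ge0 // ltW.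
exists B, (r / s); split => //.
  by rewrite divr_ge0 // ?ltW //= ltr_pdivrMr // mul1r /s; lra.
move=> n; rewrite expr_div_n mulrA ler_pdivlMr ?exprn_gt0 //.
by rewrite mulrAC ler_wpM2r ?exprn_ge0.
Qed.

(** Each of the [n] copies of x^n is at most one of the terms 1, x, ..., x^(n-1) of the geometric
    sum. *)
Lemma natmul_expr_le (x : R) n : 0 <= x < 1 -> n%:R * x ^+ n <= (1 - x)^-1.
Proof.
move=> /andP[x0 x1]; rewrite -[leRHS]mul1r ler_pdivlMr ?subr_gt0 //.
apply: (@le_trans _ _ ((\sum_(k < n) x ^+ k) * (1 - x))).
  rewrite ler_pM2r ?subr_gt0 // mulr_natl -[n in leLHS]card_ord -sumr_const.
  apply: ler_sum => k _; apply: ler_wiXn2l => //; first exact: ltW.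
  by rewrite card_ord ltnW.
have -> : (\sum_(k < n) x ^+ k) * (1 - x) = 1 - x ^+ n by rewrite -[RHS]opprB subrX1; ring.
by rewrite lerBlDr lerDl exprn_ge0.
Qed.

Lemma tempered_natmul a : tempered a -> tempered (fun n => n%:R *: a n).
Proof.
move=> ha r r01; have [B [x [B0 x01 h]]] := tempered_geometric ha r01.
exists (B * (1 - x)^-1) => n; rewrite normrZ ger0_norm // -mulrA.
apply: (@le_trans _ _ (n%:R * (B * x ^+ n))); first by rewrite ler_wpM2l.
by rewrite mulrCA ler_wpM2l // natmul_expr_le.
Qed.

Lemma tempered_shift a : tempered a -> tempered (fun n => a n.+1).
Proof.
(* Shifting the index divides by the radius, and [r] may be 0; the larger [s] is positive. *)
move=> ha r /andP[r0 r1]; pose s := (1 + r) / 2.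
have s01 : 0 <= s < 1 by apply/andP; split; rewrite /s; lra.
have s0 : 0 < s by rewrite /s; lra.
have rs : r <= s by rewrite /s; lra.
have [B hB] := ha s s01; exists (B / s) => n.
rewrite ler_pdivlMr //; apply: le_trans (hB n.+1).
rewrite exprSr [leRHS]mulrA ler_pM2r // ler_wpM2l //.
by apply: lerXn2r => //; rewrite nnegrE // ltW.
Qed.

Definition deriv_coef a : nat -> quat R := fun n => n.+1%:R *: a n.+1.

Lemma tempered_deriv_coef a : tempered a -> tempered (deriv_coef a).
Proof. by move=> /tempered_natmul/tempered_shift. Qed.

Section GeometricTail.
Variables (t : nat -> quat R) (B x : R).
Hypotheses (B0 : 0 <= B) (x01 : 0 <= x < 1).
Hypothesis ht : forall n, `|t n| <= B * x ^+ n.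

Lemma geometric_tail M N : (N <= M)%N ->
  `|\sum_(n < M) t n - \sum_(n < N) t n| <= B * x ^+ N / (1 - x).
Proof.
move=> NM; have /andP[x0 x1] := x01.
have x1' : 0 < 1 - x by rewrite subr_gt0.
(* The sharper bound with x^N - x^M is the one that is stable under induction on [M]. *)
suff [h _] : `|\sum_(n < M) t n - \sum_(n < N) t n| <= B * (x ^+ N - x ^+ M) / (1 - x) /\ true.
  apply: le_trans h _; rewrite ler_pM2r ?invr_gt0 // ler_wpM2l // lerBlDr lerDl exprn_ge0 //.
elim: M NM => [|M IH]; first by rewrite leqn0 => /eqP ->; rewrite !subrr normr0 mulr0 mul0r.
rewrite leq_eqVlt => /orP[/eqP->|]; first by rewrite !subrr normr0 mulr0 mul0r.
rewrite ltnS => /IH[h _]; split => //.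
rewrite big_ord_recr /= addrAC (le_trans (ler_normD _ _)) //.
apply: le_trans (lerD h (ht M)) _.
rewrite ler_pdivlMr // mulrDl mulfVK ?gt_eqF // exprS.
by rewrite le_eqVlt; apply/orP; left; apply/eqP; ring.
Qed.

Lemma geometric_tail_lim L N : (fun M => \sum_(n < M) t n) @ \oo --> L ->
  `|L - \sum_(n < N) t n| <= B * x ^+ N / (1 - x).
Proof.
move=> hL.
have : (fun M => `|\sum_(n < M) t n - \sum_(n < N) t n|) @ \oo --> `|L - \sum_(n < N) t n|.
  by apply: cvg_norm; apply: cvgB => //; exact: cvg_cst.
move=> /cvgr_to_le; apply; near=> M; apply: geometric_tail; near: M; exact: nbhs_infty_ge.
Unshelve. all: by end_near. Qed.

Lemma geometric_tail_cvg0 : (fun N => B * x ^+ N / (1 - x)) @ \oo --> (0 : R).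
Proof.
have /andP[x0 x1] := x01.
rewrite -(mul0r (1 - x)^-1) -(mulr0 B).
by apply: cvgMr_tmp; apply: cvgMl_tmp; apply: cvg_expr; rewrite ger0_norm.
Qed.

End GeometricTail.
End Series.

(** * Termwise differentiation of power series *)

Section Derivative.
Variable R : realType.
Implicit Types (q u v w z I : quat R) (a c d p : nat -> quat R) (F : quat R -> quat R).

Definition pow_quot q (h : R) (n : nat) : quat R :=
  \sum_(i < n.+1) (q + h%:A) ^+ (n - i) * q ^+ i.

(** A real increment commutes with [q], so the commutative factorization of a difference of powers
    applies. *)
Lemma pow_quotE q (h : R) n :
  (q + h%:A) ^+ n.+1 - q ^+ n.+1 = h *: pow_quot q h n.
Proof.
have cq : GRing.comm (q + h%:A) q.
  by rewrite /GRing.comm mulrDl mulrDr alg_comm.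
by rewrite subrXX_comm // addrAC subrr add0r mulr_algl.
Qed.

Lemma pow_quot_norm q (h s : R) n : `|q| <= s -> `|q + h%:A| <= s ->
  `|pow_quot q h n| <= n.+1%:R * s ^+ n.
Proof.
move=> qs qhs; have s0 : 0 <= s by apply: le_trans qs.
rewrite mulr_natl -[n.+1 in leRHS]card_ord -sumr_const.
apply: le_trans (ler_norm_sum _ _ _) _; apply: ler_sum => i _.
rewrite qnormM !qnormX -[X in _ <= s ^+ X](@subnK i n) -1?ltnS // exprD.
by apply: ler_pM; rewrite ?exprn_ge0 //; apply: lerXn2r => //; rewrite nnegrE.
Qed.

Lemma pow_quot_dist q (h : R) n : `|q| <= 1 -> `|q + h%:A| <= 1 ->
  `|pow_quot q h n - n.+1%:R *: q ^+ n| <= n.+1%:R ^+ 2 * `|h|.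
Proof.
move=> q1 qh1.
have -> : n.+1%:R *: q ^+ n = \sum_(i < n.+1) q ^+ (n - i) * q ^+ i.
  under eq_bigr => i _ do rewrite -exprD subnK -1?ltnS //.
  by rewrite sumr_const card_ord scaler_nat.
rewrite -sumrB expr2 -mulrA mulr_natl -[n.+1 in leRHS]card_ord -sumr_const.
apply: le_trans (ler_norm_sum _ _ _) _; apply: ler_sum => i _.
rewrite card_ord -mulrBl qnormM -[leRHS]mulr1; apply: ler_pM => //.
  case: (n - i)%N (leq_subr i n) => [_|m mn]; first by rewrite !expr0 subrr normr0 mulr_ge0.
  rewrite pow_quotE normrZ mulrC ler_wpM2r //.
  apply: le_trans (pow_quot_norm _ q1 qh1) _.
  by rewrite expr1n mulr1 ler_nat ltnW.
by rewrite qnormX exprn_ile1.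
Qed.

Definition diff_quot F q (h : R) : quat R := h^-1 *: (F (q + h%:A) - F q).

(** Three comparisons: [D] with a difference quotient, that quotient with its first [N] terms, and
    these with the differentiated terms. The second error is a geometric tail independent of [h], so
    for fixed [N] the other two are made arbitrarily small through [h]. *)
Lemma psum_derive F a q (D : quat R) : tempered a ->
  (forall q, unit_ball q -> psum a q @ \oo --> F q) -> unit_ball q ->
  diff_quot F q @ 0^' --> D ->
  psum (deriv_coef a) q @ \oo --> D.
Proof.
move=> ha hF; rewrite /unit_ball /= => q1 hD.
pose s := (1 + `|q|) / 2.
have q0 : 0 <= `|q| by [].
have s01 : 0 <= s < 1 by apply/andP; split; rewrite /s; lra.
have qs : `|q| < s by rewrite /s; lra.
have [B [x [B0 x01 hB]]] := tempered_geometric (tempered_deriv_coef ha) s01.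
have hT : forall N, `|D - psum (deriv_coef a) q N| <= B * x ^+ N / (1 - x).
  move=> N; apply/ler_addgt0Pr => e e0.
  (* By [pow_quot_dist], K |h| bounds the error made in replacing the difference quotients of the
     first [N] terms by their derivatives. *)
  pose K := \sum_(k < N) k.+1%:R ^+ 2 * `|a k.+1|.
  have K0 : 0 <= K by apply: sumr_ge0 => k _; rewrite mulr_ge0 // exprn_ge0.
  have e2 : 0 < e / 2 by rewrite divr_gt0.
  have [h [h0 hs hK Dh]] : exists h : R, [/\ h != 0, `|q + h%:A| < s, K * `|h| <= e / 2 &
      `|D - diff_quot F q h| <= e / 2].
    have hn : \forall h \near (0 : R), `|q + h%:A| < s /\ K * `|h| <= e / 2.
      apply/nbhs_ballP; exists (Num.min (s - `|q|) (e / 2 / (K + 1))) => /=.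
        by rewrite lt_min subr_gt0 qs divr_gt0 // ltr_wpDl.
      move=> h; rewrite /ball /= sub0r normrN lt_min => /andP[h1 h2]; split.
        apply: le_lt_trans (ler_normD _ _) _; rewrite qnorm_alg; lra.
      move: h2; rewrite ltr_pdivlMr ?ltr_wpDl // => h2.
      have : 0 <= `|h| by []. nra.
    near (0 : R)^' => h; exists h; split.
    - by near: h; exact: nbhs_dnbhs_neq.
    - by near: h; apply: nbhs_dnbhs; move: hn; apply: filterS => ? [].
    - by near: h; apply: nbhs_dnbhs; move: hn; apply: filterS => ? [].
    - by near: h; exact: (cvgr_dist_le _ _ hD _ e2).
  pose t k := pow_quot q h k * a k.+1.
  have ht k : `|t k| <= B * x ^+ k.
    apply: le_trans (hB k); rewrite /t /deriv_coef normrZ ger0_norm // qnormM mulrAC ler_wpM2r //.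
    by apply: pow_quot_norm; exact: ltW.
  have s1 : s < 1 by case/andP: s01.
  have hQ : (fun M => \sum_(k < M) t k) @ \oo --> diff_quot F q h.
    have hq : unit_ball (q + h%:A) by rewrite /unit_ball /=; apply: lt_trans s1.
    have : (fun M => h^-1 *: (psum a (q + h%:A) M.+1 - psum a q M.+1) : quat R) @ \oo -->
        diff_quot F q h.
      apply: cvgZl_tmp; apply: cvgB.
        by rewrite (cvg_shiftS (psum a (q + h%:A))); exact: hF.
      by rewrite (cvg_shiftS (psum a q)); exact: hF.
    apply: cvg_trans; apply: near_eq_cvg; near=> M.
    rewrite /psum -sumrB big_ord_recl !expr0 subrr add0r scaler_sumr.
    apply: eq_bigr => k _.
    by rewrite -mulrBl pow_quotE -scalerAl scalerA mulVf // scale1r.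
  have h1 := geometric_tail_lim B0 x01 ht N hQ.
  have h2 : `|\sum_(k < N) t k - psum (deriv_coef a) q N| <= e / 2.
    apply: le_trans hK; rewrite /psum -sumrB /K mulr_suml.
    apply: le_trans (ler_norm_sum _ _ _) _; apply: ler_sum => k _.
    rewrite /t /deriv_coef -scalerAr scalerAl -mulrBl qnormM mulrAC ler_wpM2r //.
    by apply: pow_quot_dist; apply: ltW => //; apply: lt_trans s1.
  set Q := diff_quot F q h in Dh h1; set S := \sum_(k < N) _ in h1 h2.
  have -> : D - psum (deriv_coef a) q N = (D - Q) + ((Q - S) + (S - psum (deriv_coef a) q N)).
    by rewrite !subrKA.
  apply: le_trans (ler_normD _ _) _; apply: le_trans (lerD Dh (ler_normD _ _)) _.
  apply: le_trans (lerD (lexx _) (lerD h1 h2)) _.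
  by rewrite addrCA -splitr.
apply/cvgrPdist_le => e e0.
have /cvgrPdist_le /(_ e e0) := geometric_tail_cvg0 B x01.
apply: filterS => N; rewrite sub0r normrN => hN.
exact: le_trans (hT N) (le_trans (ler_norm _) hN).
Unshelve. all: by end_near. Qed.

Lemma slice_pt_unit q : slice_pt (slice_unit q) (qre q) `|qim q| = q.
Proof. by rewrite /slice_pt slice_unitE; apply: quatP => /=; ring. Qed.

(** The Cauchy-Riemann equation identifies the slice derivative with the derivative in x, that is,
    along real increments. *)
Lemma psum_slice_derive F a q : tempered a -> slice_regular F ->
  (forall q, unit_ball q -> psum a q @ \oo --> F q) -> unit_ball q ->
  psum (deriv_coef a) q @ \oo --> slice_derive F q.
Proof.
move=> ha rF hF hq; apply: (psum_derive ha hF hq).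
have hI := slice_unit_sphere q.
set I := slice_unit q in hI; set x := qre q; set y := `|qim q|.
have qE : slice_pt I x y = q by exact: slice_pt_unit.
have hq' : unit_ball (slice_pt I x y) by rewrite qE.
have [dx _ _ _ /eqP CR] := rF I hI x y hq'.
have -> : slice_derive F q = slice_dx F I x y.
  rewrite /slice_derive -/I -/x -/y.
  move: CR; rewrite scaler_eq0 invr_eq0 pnatr_eq0 /= addr_eq0 => /eqP E.
  by rewrite -E -mulr2n -(scaler_nat 2 (slice_dx F I x y)) scalerA mulVf ?scale1r // pnatr_eq0.
rewrite /slice_dx derive1E.
have := dx; rewrite /derivable => /cvg_ex[l hl].
have -> : 'D_1 (fun t : R => F (slice_pt I t y)) x = l by apply: cvg_lim.
move: hl; apply: cvg_trans; apply: near_eq_cvg; near=> h.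
have hE : slice_pt I (h *: (1 : R) + x) y = q + h%:A.
  by rewrite -[in RHS]qE /slice_pt scalerDl [h *: (1 : R)]mulr1 -addrA addrC.
by rewrite /diff_quot /= hE qE.
Unshelve. all: by end_near. Qed.

End Derivative.

(** * Uniform positivity on dilated balls *)

Section Compactness.
Variable R : realType.
Implicit Types (q u v w z : quat R) (a b c d : nat -> quat R).

(** The ball is closed and lies in the image of the cube [-1, 1]^4 under the continuous coordinate
    map. *)
Lemma compact_closed_unit_ball : compact [set q : quat R | `|q| <= 1].
Proof.
pose B : set (R * R * R * R) :=
  `[-1, 1]%classic `*` `[-1, 1]%classic `*` `[-1, 1]%classic `*` `[-1, 1]%classic.
have cI := @segment_compact R (-1) 1.
have cB : compact B by exact: compact_setX (compact_setX (compact_setX cI cI) cI) cI.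
pose g (t : R * R * R * R) : quat R := t.1.1.1 *: Quat 1 0 0 0 +
  t.1.1.2 *: Quat 0 1 0 0 + t.1.2 *: Quat 0 0 1 0 + t.2 *: Quat 0 0 0 1.
have cg : continuous g.
  move=> t; repeat (apply: cvgD); apply: cvgZr_tmp.
  - apply: (cvg_comp (fun t : R * R * R * R => t.1.1) fst).
      by apply: (cvg_comp fst fst); exact: cvg_fst.
    exact: cvg_fst.
  - apply: (cvg_comp (fun t : R * R * R * R => t.1.1) snd).
      by apply: (cvg_comp fst fst); exact: cvg_fst.
    exact: cvg_snd.
  - by apply: (cvg_comp fst snd); [exact: cvg_fst | exact: cvg_snd].
  - exact: cvg_snd.
have cgB : compact (g @` B).
  by apply: continuous_compact => //; exact: continuous_subspaceT.
apply: (subclosed_compact _ cgB).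
  apply: (@preimage_closed _ _ (fun q : quat R => `|q|) [set x | x <= 1]).
    by move=> q _; exact: norm_continuous.
  exact: closed_le.
move=> q /= q1.
have hq (x : R) : x ^+ 2 <= qsqn q -> `[-1, 1]%classic x.
  rewrite /= in_itv /= -ler_norml => hx; apply: le_trans q1.
  by rewrite qnormE -sqrtr_sqr ler_sqrt ?qsqn_ge0.
exists (qre q, qi q, qj q, qk q).
  have a0 := sqr_ge0 (qre q); have a1 := sqr_ge0 (qi q).
  have a2 := sqr_ge0 (qj q); have a3 := sqr_ge0 (qk q).
  by repeat split; apply: hq; rewrite /qsqn /=; lra.
by apply: quatP; rewrite /= ; ring.
Qed.

Lemma qre_conjmul_dist p p' q q' :
  `|qre (qconj p * q) - qre (qconj p' * q')| <= `|p - p'| * `|q| + `|p'| * `|q - q'|.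
Proof.
have -> : qre (qconj p * q) - qre (qconj p' * q') =
    qre (qconj (p - p') * q + qconj p' * (q - q')) by rewrite /=; ring.
apply: le_trans (normr_qre _) _; apply: le_trans (ler_normD _ _) _.
by rewrite !qnormM !qnorm_conj.
Qed.

Lemma exprn_dist q q' n : `|q| <= 1 -> `|q'| <= 1 ->
  `|q ^+ n - q' ^+ n| <= n%:R * `|q - q'|.
Proof.
move=> q1 q'1; elim: n => [|n IH]; first by rewrite !expr0 subrr normr0 mul0r.
have -> : q ^+ n.+1 - q' ^+ n.+1 = q * (q ^+ n - q' ^+ n) + (q - q') * q' ^+ n.
  by rewrite mulrBr mulrBl -!exprS subrKA.
apply: le_trans (ler_normD _ _) _; rewrite !qnormM -natr1 mulrDl mul1r; apply: lerD.
  by rewrite -[leRHS]mul1r ler_pM.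
by rewrite ler_piMr // qnormX exprn_ile1.
Qed.

Lemma psum_dist b q q' N : `|q| <= 1 -> `|q'| <= 1 ->
  `|psum b q N - psum b q' N| <= (\sum_(k < N) k%:R * `|b k|) * `|q - q'|.
Proof.
move=> q1 q'1; rewrite /psum -sumrB mulr_suml.
apply: le_trans (ler_norm_sum _ _ _) _; apply: ler_sum => k _.
by rewrite -mulrBl qnormM mulrAC ler_wpM2r // exprn_dist.
Qed.

Section UniformPositivity.
Variables (b e : nat -> quat R) (B x B' x' : R) (C D : quat R -> quat R).
Hypotheses (B0 : 0 <= B) (x01 : 0 <= x < 1) (B'0 : 0 <= B') (x'01 : 0 <= x' < 1).
Hypothesis hb : forall n, `|b n| <= B * x ^+ n.
Hypothesis he : forall n, `|e n| <= B' * x' ^+ n.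
Hypothesis hC : forall q, `|q| <= 1 -> psum b q @ \oo --> C q.
Hypothesis hD : forall q, `|q| <= 1 -> psum e q @ \oo --> D q.
Hypothesis hpos : forall q, `|q| <= 1 -> 0 < qre (qconj (C q) * D q).

(** Compactness of the closed ball turns pointwise positivity of the limit into a uniform bound for
    one partial sum. Local uniformity comes from uniform geometric tails and from the Lipschitz
    continuity of a fixed partial sum. *)
Lemma psum_uniform_positive n : exists N (r : R),
  [/\ (n < N)%N, 0 < r & forall q, `|q| <= 1 ->
     r <= qre (qconj (psum b q N) * psum e q N)].
Proof.
pose T N := B * x ^+ N / (1 - x); pose T' N := B' * x' ^+ N / (1 - x').
have tb q k : `|q| <= 1 -> `|q ^+ k * b k| <= B * x ^+ k.
  by move=> q1; apply: le_trans (hb k); rewrite qnormM ler_piMl // qnormX exprn_ile1.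
have te q k : `|q| <= 1 -> `|q ^+ k * e k| <= B' * x' ^+ k.
  by move=> q1; apply: le_trans (he k); rewrite qnormM ler_piMl // qnormX exprn_ile1.
have CT q N : `|q| <= 1 -> `|C q - psum b q N| <= T N.
  by move=> q1; apply: (geometric_tail_lim B0 x01 (fun k => tb q k q1)); exact: hC.
have DT q N : `|q| <= 1 -> `|D q - psum e q N| <= T' N.
  by move=> q1; apply: (geometric_tail_lim B'0 x'01 (fun k => te q k q1)); exact: hD.
have bS q N : `|q| <= 1 -> `|psum b q N| <= T 0.
  move=> q1; have := geometric_tail B0 x01 (fun k => tb q k q1) (leq0n N).
  by rewrite big_ord0 subr0.
have eS q N : `|q| <= 1 -> `|psum e q N| <= T' 0.
  move=> q1; have := geometric_tail B'0 x'01 (fun k => te q k q1) (leq0n N).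
  by rewrite big_ord0 subr0.
have DS q : `|q| <= 1 -> `|D q| <= T' 0.
  by move=> q1; have := DT q 0 q1; rewrite /psum big_ord0 subr0.
pose F q := qre (qconj (C q) * D q).
pose G N q := qre (qconj (psum b q N) * psum e q N).
pose eta N := T N * T' 0 + T 0 * T' N.
have FG q N : `|q| <= 1 -> `|F q - G N q| <= eta N.
  move=> q1; apply: le_trans (qre_conjmul_dist _ _ _ _) _.
  by apply: lerD; apply: ler_pM => //; auto.
have eta0 : eta @ \oo --> (0 : R).
  have -> : (0 : R) = 0 * T' 0 + T 0 * 0 by rewrite mul0r mulr0 addr0.
  apply: cvgD.
    by apply: cvgMr_tmp; exact: (geometric_tail_cvg0 B x01).
  by apply: cvgMl_tmp; exact: (geometric_tail_cvg0 B' x'01).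
pose L N := (\sum_(k < N) k%:R * `|b k|) * T' 0 + T 0 * \sum_(k < N) k%:R * `|e k|.
have GL q q' N : `|q| <= 1 -> `|q'| <= 1 -> `|G N q - G N q'| <= L N * `|q - q'|.
  move=> q1 q'1; apply: le_trans (qre_conjmul_dist _ _ _ _) _.
  rewrite /L mulrDl [X in _ <= X + _]mulrAC -[X in _ <= _ + X]mulrA.
  by apply: lerD; apply: ler_pM => //; try exact: psum_dist; auto.
have L0 N : 0 <= L N.
  have T00 : 0 <= T 0 by apply: le_trans (bS 0 0 _); rewrite ?normr0.
  have T'00 : 0 <= T' 0 by apply: le_trans (eS 0 0 _); rewrite ?normr0.
  by rewrite /L addr_ge0 // mulr_ge0 // sumr_ge0 // => k _; rewrite mulr_ge0.
have /compact_near_coveringP cK := compact_closed_unit_ball.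
(* The bound 1 / (N + 1) is positive, depends on [N] only and is eventually below any local margin.
   The premise recurs in the property because neighbours of a point may leave the ball. *)
have H : \forall N \near \oo, [set q : quat R | `|q| <= 1] `<=`
    (fun q => `|q| <= 1 -> N.+1%:R^-1 <= G N q).
  apply: cK => q /= q1.
  (* On the way from F(q) to G_N(q'), through index [N1] at both points, four errors of at most [r]
     occur; at least 4 r remains of 8 r. *)
  have [r [Fr r0]] : exists r, F q = 8 * r /\ 0 < r.
    by exists (F q / 8); split; [field | rewrite divr_gt0 // hpos].
  have [N1 _ hN1] : \forall N \near \oo, eta N <= r.
    have /cvgrPdist_le /(_ r r0) := eta0; apply: filterS => N; rewrite sub0r normrN.
    exact: le_trans (ler_norm _).
  near=> q' N => q'1.
  have e1 := FG q N1 q1; have e2 := FG q' N1 q'1; have e3 := FG q' N q'1.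
  have h1 := hN1 N1 (leqnn _).
  have h2 : eta N <= r by apply: hN1; near: N; exact: nbhs_infty_ge.
  have e4 := GL q q' N1 q1 q'1.
  have h4 : L N1 * `|q - q'| <= r.
    have : `|q - q'| < r / (L N1 + 1).
      by near: q'; apply: cvgr_dist_lt; [exact: cvg_id | rewrite divr_gt0 // ltr_wpDl].
    rewrite ltr_pdivlMr ?ltr_wpDl // => h; have := L0 N1.
    have : 0 <= `|q - q'| by []. nra.
  have h5 : N.+1%:R^-1 < r by near: N; exact: near_infty_natSinv_lt (PosNum r0).
  move: e1 e2 e3 (le_trans e4 h4) h1 h2 h5 Fr; rewrite !ler_norml.
  move: (F q) (F q') (G N1 q) (G N1 q') (G N q') (eta N1) (eta N) (N.+1%:R^-1).
  move=> f f' g1 g1' g' m1 m s /andP[? ?] /andP[? ?] /andP[? ?] /andP[? ?]; lra.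
near \oo => N; exists N, N.+1%:R^-1; split.
- by near: N; exact: nbhs_infty_gt.
- by rewrite invr_gt0.
- by move=> q q1; apply: (near H N).
Unshelve. all: by end_near. Qed.

End UniformPositivity.

Lemma dilation_positive_of_ball c d (C D : quat R -> quat R) :
  tempered c -> tempered d ->
  (forall q, unit_ball q -> psum c q @ \oo --> C q) ->
  (forall q, unit_ball q -> psum d q @ \oo --> D q) ->
  (forall q, unit_ball q -> 0 < qre (qconj (C q) * D q)) ->
  dilation_positive c d.
Proof.
move=> tc td hC hD hpos t /andP[t0 t1] n.
have t01 : 0 <= t < 1 by rewrite ltW.
have [B [x [B0 x01 hB]]] := tempered_geometric tc t01.
have [B' [x' [B'0 x'01 hB']]] := tempered_geometric td t01.
have tq q : `|q| <= 1 -> unit_ball (t *: q).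
  move=> q1; rewrite /unit_ball /= normrZ gtr0_norm //.
  by apply: le_lt_trans t1; rewrite ler_piMr // ltW.
have pE a q : psum (fun k => t ^+ k *: a k) q = psum a (t *: q).
  by apply/funext => N; apply: eq_bigr => k _; rewrite exprZn -scalerAl scalerAr.
apply: (@psum_uniform_positive (fun k => t ^+ k *: c k) (fun k => t ^+ k *: d k)
  B x B' x' (fun q => C (t *: q)) (fun q => D (t *: q))) => //.
- by move=> k; rewrite normrZ ger0_norm ?exprn_ge0 ?(ltW t0) // mulrC.
- by move=> k; rewrite normrZ ger0_norm ?exprn_ge0 ?(ltW t0) // mulrC.
- by move=> q q1; rewrite pE; apply: hC; exact: tq.
- by move=> q q1; rewrite pE; apply: hD; exact: tq.
- by move=> q q1; apply: hpos; exact: tq.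
Qed.

End Compactness.

(** * The extremal functions *)

Section Extremal.
Variable R : realType.
Implicit Types (q u v w z : quat R) (a e : nat -> quat R).

Lemma cvg_qmull p (s : nat -> quat R) (l : quat R) :
  s @ \oo --> l -> (fun n => p * s n) @ \oo --> p * l.
Proof.
move=> /cvgrPdist_le hs; apply/cvgrPdist_le => e e0.
have p1 : 0 < `|p| + 1 by rewrite ltr_wpDl.
have := hs _ (divr_gt0 e0 p1); apply: filterS => n.
rewrite ler_pdivlMr // => h; rewrite -mulrBr qnormM mulrC.
by apply: le_trans h; rewrite ler_wpM2l // lerDl.
Qed.

Lemma psum_shift a q N : psum a q N.+1 = a 0%N + q * psum (fun n => a n.+1) q N.
Proof.
rewrite /psum big_ord_recl expr0 mul1r mulr_sumr; congr (_ + _).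
by apply: eq_bigr => k _; rewrite exprS mulrA.
Qed.

Lemma psum0_cvg a : psum a 0 @ \oo --> a 0%N.
Proof.
rewrite -(cvg_shiftS (psum a 0)).
have -> : (fun n => psum a 0 n.+1) = fun=> a 0%N.
  by apply/funext => n; rewrite psum_shift mul0r addr0.
exact: cvg_cst.
Qed.

Lemma psum_eq0_head e : tempered e ->
  (forall t : R, 0 < t < 1 -> psum e t%:A @ \oo --> (0 : quat R)) -> e 0%N = 0.
Proof.
move=> te h.
have h2 : 0 <= (2^-1 : R) < 1 by apply/andP; split; lra.
have [B hB] := te _ h2.
have B0 : 0 <= B by apply: le_trans (hB 0); rewrite expr0 mulr1.
apply/eqP; rewrite -normr_eq0 eq_le normr_ge0 andbT leNgt; apply/negP => e0.
(* With ratio 2t, the tail after the head is at most 2 t B / (1 - 2t). This [t] gives 2 t B <= |e_0|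
   / 4 and 1 - 2t >= 3/4, so the tail cannot cancel the head. *)
pose t : R := Num.min (8^-1) (`|e 0%N| / (8 * (B + 1))).
have t8 : t <= 8^-1 by rewrite /t ge_min lexx.
have te0 : t * (8 * (B + 1)) <= `|e 0%N|.
  by rewrite -ler_pdivlMr ?mulr_gt0 ?ltr_wpDl // /t ge_min lexx orbT.
have t0 : 0 < t by rewrite /t lt_min invr_gt0 ltr0n divr_gt0 // mulr_gt0 // ltr_wpDl.
have t01 : 0 < t < 1 by apply/andP; split; lra.
have x01 : 0 <= t / 2^-1 < 1 by apply/andP; split; rewrite invrK; lra.
have ht n : `|(t%:A : quat R) ^+ n * e n| <= B * (t / 2^-1) ^+ n.
  rewrite qnormM qnormX qnorm_alg gtr0_norm // expr_div_n mulrA ler_pdivlMr ?exprn_gt0 //.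
  by rewrite -mulrA [leRHS]mulrC ler_wpM2l // exprn_ge0 // ltW.
have := geometric_tail_lim B0 x01 ht 1 (h t t01).
rewrite big_ord1 expr0 mul1r sub0r normrN expr1 invrK ler_pdivlMr; last by lra.
move: (`|e 0%N|) e0 te0 => E E0 hE hE'.
have : E * t <= E * 8^-1 by rewrite ler_pM2l.
have : 0 <= B * t by rewrite mulr_ge0 // ltW.
lra.
Qed.

(** Once the head vanishes, dividing by [t] gives the same hypothesis for the shifted sequence. *)
Lemma psum_eq0 e : tempered e ->
  (forall t : R, 0 < t < 1 -> psum e t%:A @ \oo --> (0 : quat R)) -> forall n, e n = 0.
Proof.
move=> te h n; elim: n e te h => [|n IH] e te h; first exact: psum_eq0_head.
apply: (IH (fun n => e n.+1)); first exact: tempered_shift.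
move=> t t01; have e0 := psum_eq0_head te h.
have tA : (t%:A : quat R) != 0.
  by rewrite -normr_eq0 qnorm_alg normr_eq0; case/andP: t01 => /gt_eqF ->.
have := h t t01; rewrite -(cvg_shiftS (psum e t%:A)) => /(@cvg_qmull (t%:A)^-1 _ _).
rewrite mulr0; apply: cvg_trans; apply: near_eq_cvg; near=> N.
by rewrite /= psum_shift e0 add0r mulKr.
Unshelve. all: by end_near. Qed.

Lemma psum_unique a b (F : quat R -> quat R) :
  (forall q, unit_ball q -> psum a q @ \oo --> F q) ->
  (forall q, unit_ball q -> psum b q @ \oo --> F q) -> forall n, a n = b n.
Proof.
move=> ha hb n; apply/eqP; rewrite -subr_eq0; apply/eqP.
have h q : unit_ball q -> psum (fun n => a n - b n) q @ \oo --> (0 : quat R).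
  move=> hq; rewrite -(subrr (F q)).
  have -> : psum (fun n => a n - b n) q = fun N => psum a q N - psum b q N.
    by apply/funext => N; rewrite /psum -sumrB; apply: eq_bigr => k _; rewrite mulrBr.
  by apply: cvgB; [exact: ha | exact: hb].
apply: (psum_eq0 (cvg_tempered h)) => t /andP[t0 t1]; apply: h.
by rewrite /unit_ball /= qnorm_alg gtr0_norm.
Qed.

Lemma qpseries_finite a q K : (forall n, (K <= n)%N -> a n = 0) ->
  qpseries a q = \sum_(n < K) q ^+ n * a n.
Proof.
move=> ha; apply: (@cvg_lim _ (@norm_hausdorff _ _)) => //.
apply: (cvg_near_cst _); near=> N; rewrite /series /= big_mkord.
have KN : (K <= N)%N by near: N; exact: nbhs_infty_ge.
rewrite (big_ord_widen _ (fun n => q ^+ n * a n) KN) [RHS]big_mkcond.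
by apply: eq_bigr => n _; case: ltnP => // h; rewrite ha // mulr0.
Unshelve. all: by end_near. Qed.

(* Multiplying the partial sums of [sum q^n u^n] by the symmetrization
   [1 - 2 Re(u) q + q^2] of [1 - q u] telescopes. *)
Lemma reg_recip_cvg u q : `|u| = 1 -> unit_ball q ->
  psum (fun n => u ^+ n) q @ \oo --> reg_recip (one_sub_qmul u) q.
Proof.
move=> u1; rewrite /unit_ball /= => q1.
have uu : qconj u * u = 1 by rewrite qconj_mul u1 expr1n scale1r.
have uu' : u * qconj u = 1 by rewrite qmul_conj u1 expr1n scale1r.
have cE n : (2 <= n)%N -> reg_conj (one_sub_qmul u) n = 0.
  by case: n => [|[|n]] // _; rewrite /reg_conj /one_sub_qmul /= qconj0.
have c0 : reg_conj (one_sub_qmul u) 0 = 1 by rewrite /reg_conj /one_sub_qmul /= qconj1.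
have c1 : reg_conj (one_sub_qmul u) 1 = - qconj u.
  by rewrite /reg_conj /one_sub_qmul /=; apply: quatP => /=; ring.
have sE n : (3 <= n)%N -> reg_sym (one_sub_qmul u) n = 0.
  move=> n3; apply: big1 => i _; case: (ltnP i 2) => hi; last first.
    by rewrite /one_sub_qmul !gtn_eqF ?mul0r // ltnW.
  have i2n : (i + 2 <= n)%N by apply: leq_trans n3; rewrite addn2 !ltnS.
  by rewrite cE ?mulr0 // leq_subRL // (leq_trans (leq_addr 2 i)).
have s0 : reg_sym (one_sub_qmul u) 0 = 1 by rewrite /reg_sym /reg_mul big_ord1 c0 mulr1.
have s1 : reg_sym (one_sub_qmul u) 1 = - (u + qconj u).
  rewrite /reg_sym /reg_mul !big_ord_recl big_ord0 /= addr0 subn0 subnn c0 c1.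
  by rewrite /one_sub_qmul /= mul1r mulr1 addrC opprD.
have s2 : reg_sym (one_sub_qmul u) 2 = 1.
  rewrite /reg_sym /reg_mul !big_ord_recl big_ord0 /= addr0 subn0 cE // c1.
  by rewrite /one_sub_qmul /= mulr0 add0r mul0r addr0 mulrNN.
rewrite /reg_recip (qpseries_finite q sE) (qpseries_finite q cE).
rewrite !big_ord_recl !big_ord0 /= s0 s1 s2 c0 c1 expr0 expr1 !mulr1 !addr0.
set D := 1 + _; set N := 1 + _.
have step M : D * (q ^+ M * u ^+ M) = q ^+ M * N * u ^+ M - q ^+ M.+1 * N * u ^+ M.+1.
  have -> : q ^+ M * N * u ^+ M - q ^+ M.+1 * N * u ^+ M.+1 =
      q ^+ M * (N - q * N * u) * u ^+ M.
    by rewrite mulrBr mulrBl exprSr [u ^+ _.+1]exprS !mulrA.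
  have -> : N - q * N * u = D.
    have -> : q * N * u = q * u - q ^+ 2.
      by rewrite /N mulrDr mulr1 mulrDl !mulrN mulNr mulrA -expr2 -mulrA uu mulr1.
    rewrite [in RHS]/D; have -> : q * - (u + qconj u) = q * - qconj u - q * u.
      by rewrite opprD mulrDr addrC !mulrN.
    by rewrite opprB /N -addrA; congr (_ + _); rewrite addrA addrAC.
  rewrite !mulrA; congr (_ * _).
  (* In this form [D] is a polynomial in [q] with real coefficients, hence commutes with the powers
     of [q]. *)
  have -> : D = 1 - (2 * qre u) *: q + q ^+ 2.
    rewrite /D addrA; congr (_ + _ + _).
    by rewrite qconj_alt addrC subrK mulrN mulr_algr.
  rewrite mulrDr mulrDl mulrBr mulrBl mulr1 mul1r -!exprD addnC.
  by rewrite -scalerAl -scalerAr -exprS -exprSr.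
have N0 : N != 0.
  apply/negP => /eqP; rewrite /N mulrN => /subr0_eq /(congr1 Num.norm).
  rewrite qnorm1 qnormM qnorm_conj u1 mulr1 => q1'; move: q1.
  by rewrite -q1' ltxx.
have DS M : D * psum (fun n => u ^+ n) q M = N - q ^+ M * N * u ^+ M.
  elim: M => [|M IH]; first by rewrite /psum big_ord0 mulr0 !expr0 mul1r mulr1 subrr.
  by rewrite /psum big_ord_recr /= mulrDr step -/(psum _ _ _) IH addrA subrK.
(* If D = 0, the case M = 1 of [DS] gives N = q N u, so |N| = |q| |N| with |q| < 1 and N nonzero. *)
have D0 : D != 0.
  apply/negP => /eqP D0; have := DS 1; rewrite D0 mul0r !expr1.
  move=> /esym /subr0_eq /(congr1 Num.norm).
  rewrite !qnormM u1 mulr1 -[LHS]mul1r => /(mulIf _) E.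
  by move: q1; rewrite -E ?ltxx // normr_eq0.
have -> : psum (fun n => u ^+ n) q = fun M => D^-1 * (N - q ^+ M * N * u ^+ M).
  by apply/funext => M; rewrite -DS mulKr.
apply: cvg_qmull; rewrite -[X in _ --> X]subr0; apply: cvgB; first exact: cvg_cst.
apply/cvgrPdist_le => e e0.
have /cvgrPdist_le /(_ _ e0) : (fun M => `|N| * `|q| ^+ M) @ \oo --> (0 : R).
  by rewrite -(mulr0 `|N|); apply: cvgMl_tmp; apply: cvg_expr; rewrite normr_id.
apply: filterS => M; rewrite !sub0r !normrN; apply: le_trans.
by rewrite !qnormM !qnormX u1 expr1n mulr1 mulrC ler_norm.
Qed.

End Extremal.

(** * From starlikeness of q f' to positivity of dilations *)

Section StarlikeData.
Variables (R : realType) (f : quat R -> quat R) (al : nat -> quat R).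
Hypothesis al1 : al 1%N = 1.
Hypothesis hf : slice_regular f.
Hypothesis hal : forall q, unit_ball q -> psum al q @ \oo --> f q.
Let g q := q * slice_derive f q.
Hypothesis hstar : slice_starlike g.

(** For q nonzero, g(q)^-1 q g'(q) = f'(q)^-1 g'(q), since g(q) = q f'(q) pointwise;
    [qre_conjmul_sqn] removes the inverse. *)
Lemma starlike_dilation_positive :
  dilation_positive (deriv_coef al) (fun n => n.+1%:R *: deriv_coef al n).
Proof.
have [[rg g0 g1] hre] := hstar.
have ta := cvg_tempered hal.
have hC q : unit_ball q -> psum (deriv_coef al) q @ \oo --> slice_derive f q.
  exact: (psum_slice_derive ta hf hal).
pose ga n := n%:R *: al n.
have tga : tempered ga by exact: tempered_natmul.
have hg q : unit_ball q -> psum ga q @ \oo --> g q.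
  move=> /hC hq; rewrite -(cvg_shiftS (psum ga q)).
  have -> : (fun n => psum ga q n.+1) = fun n => q * psum (deriv_coef al) q n.
    by apply/funext => n; rewrite psum_shift /ga scale0r add0r.
  exact: cvg_qmull.
have hD q : unit_ball q -> psum (deriv_coef ga) q @ \oo --> slice_derive g q.
  exact: (psum_slice_derive tga rg hg).
apply: (dilation_positive_of_ball (tempered_deriv_coef ta) (tempered_deriv_coef tga) hC hD) => q hq.
(* At 0 [starlike_quotient] is 1 by convention and gives no information; there both derivatives
   equal 1. *)
have [->|q0] := eqVneq q 0.
  have b0 : unit_ball (0 : quat R) by rewrite /unit_ball /= normr0.
  have -> : slice_derive f 0 = 1.
    have := @psum0_cvg R (deriv_coef al); rewrite /deriv_coef al1 scale1r => h1.
    exact: (cvg_unique (@norm_hausdorff _ _) (hC 0 b0) h1).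
  by rewrite g1 qconj1 mulr1 ltr01.
have gq0 : g q != 0 by apply/negP => /eqP /(g0 q hq) /eqP; rewrite (negbTE q0).
have C0 : slice_derive f q != 0.
  by apply: contra_neq gq0; rewrite /g => ->; rewrite mulr0.
have := hre q hq; rewrite /starlike_quotient (negbTE q0) /g invrM // mulrVK //.
move=> h; rewrite (@qre_conjmul_sqn _ _ _ ((slice_derive f q)^-1 * slice_derive g q)).
  by rewrite mulr_gt0 // exprn_gt0 // normr_gt0.
by rewrite mulVKr.
Qed.

End StarlikeData.

Theorem theorem1p3 (R : realType) (f : quat R -> quat R) (a : nat -> quat R)
    (hf : slice_regular f)
    (hexp : forall q : quat R, unit_ball q ->
       (fun N : nat => q + \sum_(2 <= n < N) q ^+ n * a n) @ \oo --> f q)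
    (hstar : slice_starlike (fun q : quat R => q * slice_derive f q)) :
  (forall n : nat, (2 <= n)%N -> `|a n| <= 1) /\
  (forall n : nat, (2 <= n)%N ->
     (`|a n| = 1 <->
      exists u : quat R, `|u| = 1 /\
        forall q : quat R, unit_ball q ->
          f q = q * reg_recip (one_sub_qmul u) q)).
Proof.
(* The full coefficient sequence of f, with 0 and 1 in the first two places, where [a] is
   unconstrained. *)
pose al n : quat R := if n == 0%N then 0 else if n == 1%N then 1 else a n.
have alE n : (2 <= n)%N -> al n = a n by case: n => [|[|n]].
have hal q : unit_ball q -> psum al q @ \oo --> f q.
  move=> /hexp; apply: cvg_trans; apply: near_eq_cvg; near=> N.
  have N2 : (2 <= N)%N by near: N; exact: nbhs_infty_ge.
  rewrite /psum -(big_mkord xpredT (fun n => q ^+ n * al n)).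
  rewrite big_ltn ?(ltnW N2) // big_ltn // /al mulr0 add0r expr1 mulr1; congr (_ + _).
  by apply: eq_big_nat => n /andP[n2 _]; rewrite -/(al n) alE.
set c := deriv_coef al.
have c0 : c 0%N = 1 by rewrite /c /deriv_coef /al /= scale1r.
have cE n : (0 < n)%N -> c n = n.+1%:R *: a n.+1 by move=> n0; rewrite /c /deriv_coef alE.
have hpos := starlike_dilation_positive (erefl : al 1%N = 1) hf hal hstar.
rewrite -/c in hpos.
have [p hp] := reg_quotient_exists (fun n => n.+1%:R *: c n) c0.
have d0 : 1%:R *: c 0%N = 1 by rewrite c0 scale1r.
have p2 n : (0 < n)%N -> `|p n| <= 2 by exact: (caratheodory_le2 c0 d0 hp hpos).
have NcE n : (0 < n)%N -> `|c n| = n.+1%:R * `|a n.+1|.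
  by move=> n0; rewrite cE // normrZ ger0_norm.
split=> [[|[|n]] // _|[|[|n]] // _].
  have := starlike_coef_le c0 hp p2 n.+1; rewrite NcE // -{2}[n.+2%:R]mulr1.
  by rewrite ler_pM2l.
split => [an1|[u [u1 fE]]].
  (* A coefficient of f of modulus 1 gives equality in the growth bound for f', hence extremality of
     [p 1]. *)
  have p1 : `|p 1%N| = 2.
    by apply: (starlike_coef_eq c0 hp p2 (n := n.+1)) => //; rewrite NcE // an1 mulr1.
  pose u := 2^-1 *: p 1%N.
  have u1 : `|u| = 1 by rewrite normrZ p1 ger0_norm // mulVf.
  have cu := starlike_coef_extremal c0 hp (fun k k0 => caratheodory_eq2 c0 d0 hp hpos k0 p1).
  have alu k : al k.+1 = u ^+ k.
    by apply: (scalerI (a := k.+1%:R)); rewrite ?pnatr_eq0 // -cu.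
  exists u; split => // q hq.
  suff h : psum al q @ \oo --> q * reg_recip (one_sub_qmul u) q.
    exact: (cvg_unique (@norm_hausdorff _ _) (hal q hq) h).
  rewrite -(cvg_shiftS (psum al q)).
  have -> : (fun n => psum al q n.+1) = fun n => q * psum (fun k => u ^+ k) q n.
    apply/funext => k; rewrite psum_shift add0r; congr (_ * _).
    by apply: eq_bigr => j _; rewrite alu.
  exact: cvg_qmull (reg_recip_cvg u1 hq).
(* The coefficients of the extremal function; uniqueness of power series expansions identifies them
   with those of f. *)
pose be k : quat R := if k is j.+1 then u ^+ j else 0.
have hbe q : unit_ball q -> psum be q @ \oo --> f q.
  move=> hq; rewrite fE // -(cvg_shiftS (psum be q)).
  have -> : (fun n => psum be q n.+1) = fun n => q * psum (fun k => u ^+ k) q n.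
    by apply/funext => k; rewrite psum_shift add0r.
  exact: cvg_qmull (reg_recip_cvg u1 hq).
by rewrite -alE // (psum_unique hal hbe) qnormX u1 expr1n.
Unshelve. all: by end_near. Qed.
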